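(* Let $R$ be a Dedekind domain with field of fractions $K$, let $d\ge 1$, $\mathbf{x}=(x_1,\dots,x_d)$, and let $\mathcal S$ be an infinite set of prime ideals of $R$ of finite index. Let $f_1(\mathbf{x}),\dots,f_n(\mathbf{x})$ be power series in $\mathcal L_d(R,\mathcal S)$. Then $f_1,\dots,f_n$ are algebraically dependent over $K(\mathbf{x})$ if and only if there exist integers $a_1,\dots,a_n$, not all zero, such that $$f_1(\mathbf{x})^{a_1}\cdots f_n(\mathbf{x})^{a_n}\in K(\mathbf{x}).$$
   Context: For a prime ideal $\mathfrak p$ of $R$, $R_{\mathfrak p}$ denotes the localization of $R$ at $\mathfrak p$ (viewed inside $K$). For a rational function $r=A/B\in K(\mathbf{x})$ with $A,B$ coprime polynomials, its height is $H(r)=\max(\deg A,\deg B)$ (total degrees). $\mathcal L_d(R,\mathcal S)$ is the set of power series $f\in K[[\mathbf{x}]]$ with constant term $1$ such that there is a constant $C>0$ (independent of $\mathfrak p$) such that for every $\mathfrak p\in\mathcal S$: (i) $f\in R_{\mathfrak p}[[\mathbf{x}]]$; (ii) the residue field $R/\mathfrak p$ is finite, of characteristic $p$ say; (iii) there exist a positive integer $k$ and $A\in K(\mathbf{x})\cap R_{\mathfrak p}[[\mathbf{x}]]$ with $f(\mathbf{x})\equiv A(\mathbf{x})f(\mathbf{x}^{p^k}) \bmod \mathfrak pR_{\mathfrak p}[[\mathbf{x}]]$, where $\mathbf{x}^{p^k}=(x_1^{p^k},\dots,x_d^{p^k})$; (iv) $H(A)\le Cp^k$. *)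

(* Defs.v *)
From HB Require Import structures.
From mathcomp Require Import all_boot all_order all_algebra.
From mathcomp Require Import mpoly.
From mathcomp Require Import boolp classical_sets functions cardinality.

Set Implicit Arguments.
Unset Strict Implicit.
Unset Printing Implicit Defensive.

Import Order.TTheory GRing.Theory.
Local Open Scope ring_scope.
Local Open Scope classical_set_scope.

(* Formal power series in d variables, indexed like the coefficients of       *)
(* {mpoly R[d]} by the exponent vectors 'X_{1..d}.                            *)
Record mps (d : nat) (R : Type) := MPs { mps_coef :> 'X_{1..d} -> R }.

Lemma mpsP (d : nat) (R : Type) (f g : mps d R) :
  (forall m, f m = g m) <-> f = g.
Proof.
by split=> [|->//]; case: f g => [f] [g] /= fg; congr MPs; apply/funext.
Qed.

HB.instance Definition _ (d : nat) (R : Type) := gen_eqMixin (mps d R).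
HB.instance Definition _ (d : nat) (R : Type) := gen_choiceMixin (mps d R).

Section Zmodule.
Context {d : nat} {R : zmodType}.
Implicit Types f g h : mps d R.

Definition mps_zero : mps d R := MPs (fun=> 0).
Definition mps_opp f : mps d R := MPs (fun m => - f m).
Definition mps_add f g : mps d R := MPs (fun m => f m + g m).

Fact mps_addA : associative mps_add.
Proof. by move=> f g h; apply/mpsP => m /=; rewrite addrA. Qed.

Fact mps_addC : commutative mps_add.
Proof. by move=> f g; apply/mpsP => m /=; rewrite addrC. Qed.

Fact mps_add0 : left_id mps_zero mps_add.
Proof. by move=> f; apply/mpsP => m /=; rewrite add0r. Qed.

Fact mps_addN : left_inverse mps_zero mps_opp mps_add.
Proof. by move=> f; apply/mpsP => m /=; rewrite addNr. Qed.

HB.instance Definition _ :=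
  GRing.isZmodule.Build (mps d R) mps_addA mps_addC mps_add0 mps_addN.
End Zmodule.

Section Ring.
Context {d : nat} {R : comNzRingType}.
Implicit Types f g h : mps d R.

Definition mps_one : mps d R := MPs (fun m => (m == 0%MM)%:R).

(* Same shape as mcoeffM for polynomials. *)
Definition mps_mul f g : mps d R :=
  MPs (fun m => \sum_(k : 'X_{1..d < (mdeg m).+1, (mdeg m).+1}
                       | m == (k.1 + k.2)%MM) f k.1 * g k.2).

Let tr (N : nat) f : {mpoly R[d]} := \sum_(m : 'X_{1..d < N}) f m *: 'X_[m].

Let trE N f m : (mdeg m < N)%N -> (tr N f)@_m = f m.
Proof.
move=> lt_mN; rewrite /tr raddf_sum /= (bigD1 (BMultinom lt_mN)) //=.
rewrite mcoeffZ mcoeffX eqxx mulr1 big1 ?addr0 // => k ne_k.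
rewrite mcoeffZ mcoeffX; case: eqP => [e|_]; last by rewrite mulr0.
by case/eqP: ne_k; apply/val_inj.
Qed.

Let eqM m (p p' q q' : {mpoly R[d]}) :
  (forall k, (mdeg k <= mdeg m)%N -> p@_k = p'@_k) ->
  (forall k, (mdeg k <= mdeg m)%N -> q@_k = q'@_k) ->
  (p * q)@_m = (p' * q')@_m.
Proof.
move=> ep eq; rewrite !mcoeffM; apply: eq_bigr => k _.
by rewrite ep ?eq // -ltnS bmdeg.
Qed.

Let mulE N f g m : (mdeg m < N)%N -> mps_mul f g m = (tr N f * tr N g)@_m.
Proof.
move=> lt_mN; rewrite mcoeffM; apply: eq_bigr => k _.
by rewrite !trE //; apply: leq_ltn_trans lt_mN; rewrite -ltnS bmdeg.
Qed.

Fact mps_mulA : associative mps_mul.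
Proof.
move=> f g h; apply/mpsP => m; rewrite !(mulE _ _ (ltnSn _)).
transitivity ((tr (mdeg m).+1 f * (tr (mdeg m).+1 g * tr (mdeg m).+1 h))@_m).
  by apply: eqM => // k le_km; rewrite trE // (@mulE (mdeg m).+1).
rewrite mulrA.
by apply: eqM => // k le_km; rewrite trE // (@mulE (mdeg m).+1).
Qed.

Fact mps_mulC : commutative mps_mul.
Proof. by move=> f g; apply/mpsP => m; rewrite !(mulE _ _ (ltnSn _)) mulrC. Qed.

Fact mps_mul1 : left_id mps_one mps_mul.
Proof.
move=> f; apply/mpsP => m; rewrite (mulE _ _ (ltnSn _)).
rewrite -[RHS](@trE (mdeg m).+1) // -[in RHS](mul1r (tr _ f)).
by apply: eqM => // k le_km; rewrite trE //= mcoeff1.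
Qed.

Fact mps_mulDl : left_distributive mps_mul +%R.
Proof.
move=> f g h; apply/mpsP => m /=; rewrite -big_split /=.
by apply: eq_bigr => k _; rewrite mulrDl.
Qed.

Fact mps_one_neq0 : mps_one != 0.
Proof.
by apply/eqP => /mpsP /(_ 0%MM) /eqP; rewrite /= eqxx oner_eq0.
Qed.

HB.instance Definition _ := GRing.Zmodule_isComNzRing.Build (mps d R)
  mps_mulA mps_mulC mps_mul1 mps_mulDl mps_one_neq0.

Definition mps_unit : pred (mps d R) := fun f => `[< exists g, g * f = 1 >].

Definition mps_inv f : mps d R :=
  if pselect (exists g, g * f = 1) is left ex then projT1 (cid ex) else f.

Fact mps_mulVr : {in mps_unit, left_inverse 1 mps_inv *%R}.
Proof.
move=> f /asboolP uf; rewrite /mps_inv.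
by case: pselect => // ex; exact: (projT2 (cid ex)).
Qed.

Fact mps_unitP f g : g * f = 1 -> mps_unit f.
Proof. by move=> gf; apply/asboolP; exists g. Qed.

Fact mps_inv_out : {in [predC mps_unit], mps_inv =1 id}.
Proof.
move=> f; rewrite inE /mps_inv; case: pselect => // ex /negP[].
exact/asboolP.
Qed.

HB.instance Definition _ := GRing.ComNzRing_hasMulInverse.Build (mps d R)
  mps_mulVr mps_unitP mps_inv_out.
End Ring.

Section Domain.
Context {d : nat} {R : idomainType}.
Implicit Types f g : mps d R.

Let lowest f : f != 0 ->
  exists2 m, f m != 0 & forall k, f k != 0 -> (m <= k)%O.
Proof.
move=> nz_f; have [m nz_m] : exists m, f m != 0.
  apply: contrapT => nf; case/eqP: nz_f; apply/mpsP => m /=.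
  by apply/eqP; apply: contrapT => /negP nz; apply: nf; exists m.
elim/(well_founded_ind (@ltom_wf d)): m nz_m => m IH nz_m.
case: (pselect (exists2 k, f k != 0 & (k < m)%O)) => [[k nz_k lt_km]|no].
  exact: IH lt_km nz_k.
exists m => // k nz_k; rewrite leNgt; apply/negP => lt_km.
by apply: no; exists k.
Qed.

Fact mps_mulf_eq0 f g : f * g = 0 -> (f == 0) || (g == 0).
Proof.
move=> fg0; apply/negPn; rewrite negb_or; apply/negP.
move=> /andP[/lowest[m nz_m le_m] /lowest[n nz_n le_n]].
have lt_m : (mdeg m < (mdeg (m + n)%MM).+1)%N by rewrite mdegD ltnS leq_addr.
have lt_n : (mdeg n < (mdeg (m + n)%MM).+1)%N by rewrite mdegD ltnS leq_addl.
move/mpsP/(_ (m + n)%MM): fg0 => /= /eqP; apply/negP.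
rewrite (bigD1 (BMultinom lt_m, BMultinom lt_n)) //= big1 ?addr0 ?mulf_neq0 //.
move=> [[k1 /= h1] [k2 /= h2]] /andP[/eqP e ne].
apply/eqP/negPn; rewrite mulf_eq0 negb_or; apply/negP => /andP[nz1 nz2].
have := le_m _ nz1; rewrite le_eqVlt => /predU1P[e1|lt1]; last first.
  have: ((m + n)%MM < (k1 + k2)%MM)%O.
    apply: (@lt_le_trans _ _ (k1 + n)%MM); first by rewrite ltmc_add2l.
    by rewrite lemc_add2r le_n.
  by rewrite e ltxx.
subst k1; have e2 := addmI e; subst k2.
by case/eqP: ne; congr pair; exact: val_inj.
Qed.

HB.instance Definition _ :=
  GRing.ComUnitRing_isIntegral.Build (mps d R) mps_mulf_eq0.
End Domain.

Local Notation "x %:F" := (FracField.tofrac x).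

(* K(x) is realized as a subfield of Frac(K[[x]]), so that polynomials, power *)
(* series and rational functions can be compared inside one field.            *)
Section RationalFunctions.
Context {d : nat} {K : fieldType}.
Implicit Types (A B : {mpoly K[d]}) (r : {fraction mps d K}).

Definition mps_of_mpoly A : mps d K := MPs (fun m => A@_m).

Definition ratfrac A B : {fraction mps d K} :=
  (mps_of_mpoly A)%:F / (mps_of_mpoly B)%:F.

Definition ratfun : set {fraction mps d K} :=
  [set r | exists A B, B != 0 /\ r = ratfrac A B].

Definition mpoly_coprime A B : Prop :=
  forall D A' B', A = D * A' -> B = D * B' -> D \is a GRing.unit.

Definition mpoly_deg A : nat := (msize A).-1.

Definition has_height r (h : nat) : Prop :=
  exists A B, [/\ B != 0, mpoly_coprime A B, r = ratfrac A B
                & h = maxn (mpoly_deg A) (mpoly_deg B)].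

End RationalFunctions.

(* The power series f(x_1^N, ..., x_d^N), for N > 0.                          *)
Definition mps_subst_pow (d : nat) (K : fieldType) (N : nat) (f : mps d K) :
  mps d K :=
  MPs (fun m => if [forall i : 'I_d, (N %| m i)%N]
                then f [multinom (m i %/ N)%N | i < d] else 0).

Definition mps_over (d : nat) (K : fieldType) (T : set K) : set (mps d K) :=
  [set f : mps d K | forall m, T (f m)].

Definition algebraically_dependent (L : fieldType) (F : set L) (n : nat)
    (z : 'I_n -> L) : Prop :=
  exists P : {mpoly L[n]}, [/\ P != 0, forall m, F P@_m & P.@[z] = 0].

(* The type idealr R only contains proper ideals, which is harmless here: the *)
(* unit ideal is generated by 1. Its elements are boolean predicates, which,  *)
(* in the presence of the classical axioms of boolp, covers all ideals.       *)
(* A field counts as a Dedekind domain.                                       *)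
Definition noetherian (R : idomainType) : Prop :=
  forall I : idealr R, exists s : seq R, forall x,
    x \in I <-> exists c : 'I_(size s) -> R, x = \sum_i c i * s`_i.

Definition integrally_closed (R : idomainType) : Prop :=
  forall z : {fraction R},
    integralOver (@FracField.tofrac R) z -> exists x : R, z = x%:F.

Definition dedekind (R : idomainType) : Prop :=
  [/\ noetherian R, integrally_closed R
    & forall p : prime_idealr R, (exists2 x, x \in p & x != 0) ->
      forall I : idealr R, {subset p <= I} -> {subset I <= p}].

(* Two prime ideals with the same elements are equal, so that the cardinality *)
(* of a set of elements of prime_idealr R has its expected meaning.           *)
Lemma prime_idealr_inj (R : nzRingType) (p q : prime_idealr R) :
  p =i q -> p = q.
Proof.
move=> pq; have : (p : R -> bool) = q by apply/funext => x; exact: pq.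
case: p q {pq} => p [[p1] [p2] [p3] [p4]] [q [[q1] [q2] [q3] [q4]]] /= e.
subst q; congr (PrimeIdealr.Pack (PrimeIdealr.Class _ _ _ _));
  congr (_ _); exact: Prop_irrelevance.
Qed.

Section Localization.
Context {R : idomainType}.
Implicit Type p : prime_idealr R.

Definition localization p : set {fraction R} :=
  [set z | exists a b : R, b \notin p /\ z = a%:F / b%:F].

(* The maximal ideal pR_p of R_p.                                             *)
Definition localization_max p : set {fraction R} :=
  [set z | exists a b : R, [/\ a \in p, b \notin p & z = a%:F / b%:F]].

Definition finite_index p : Prop := finite_set [set: {ideal_quot p}].

(* The power series a is the expansion of the rational function A; the bound  *)
(* C can be taken to be an integer since a real one can be rounded up.        *)
Definition lucas (d : nat) (S : set (prime_idealr R)) :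
  set (mps d {fraction R}) :=
  [set f : mps d {fraction R} | f 0%MM = 1 /\
    exists2 C : nat, (0 < C)%N & forall p, S p ->
    [/\ mps_over (localization p) f,
        finite_index p
      & exists2 q : nat, q \in [pchar {ideal_quot p}] &
        exists (k : nat) (a : mps d {fraction R}),
          [/\ (0 < k)%N,
              ratfun a%:F,
              mps_over (localization p) a,
              mps_over (localization_max p)
                (f - a * mps_subst_pow (q ^ k) f)
            & exists2 h, has_height a%:F h & (h <= C * q ^ k)%N]]].

End Localization.

(* Main.v *)
From HB Require Import structures.
Require Import Defs.
From mathcomp Require Import all_boot all_order all_algebra.
From mathcomp Require Import generic_quotient ring_quotient ssrAC.
From mathcomp Require Import mpoly zify.
From mathcomp Require Import boolp classical_sets functions cardinality.

(* Suppose that the f_i satisfy a polynomial relation over K(x). For all but  *)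
(* finitely many p in S it reduces to a relation over k(x), where k is the    *)
(* residue field at p. As k is finite, some power q of its characteristic     *)
(* satisfies y ^ q = y on k, and iterating the congruence gives V_i * f_i =   *)
(* U_i * f_i ^ q over k, with U_i and V_i of degree O(q). By an argument in   *)
(* the style of Kummer, some quotient r = f ^ m / f ^ m' of two monomials is  *)
(* then rational over k, and since r ^ (q - 1) has height O(q), the height of *)
(* r is bounded independently of p. The existence of such a fraction is the   *)
(* vanishing of minors that have a meaning over the localization at p. There  *)
(* are finitely many pairs (m, m'), so a single p, avoiding the numerators of *)
(* finitely many nonzero minors, suffices to make f ^ m / f ^ m' rational     *)
(* over K. Factoriality of k[x] is avoided by substituting t * x for x:       *)
(* heights are bounded for rational functions of t alone, over the fraction   *)
(* field of k[x], and a final homogeneity argument recovers polynomials in x. *)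

Set Implicit Arguments.
Unset Strict Implicit.
Unset Printing Implicit Defensive.

Import Order.TTheory GRing.Theory.
Local Open Scope ring_scope.
Local Open Scope classical_set_scope.

(** * Fractions *)

(** Write f^m for a monomial in the f_i. If the product of the f_i^(a_i) is a rational function r,
    separating positive and negative exponents gives the relation f^m - r * f^m' = 0
    ([dependent_of_multiplicative]). Conversely, it is enough to find m <> m' and nonzero
    polynomials P, Q with P * f^m = Q * f^m' ([multiplicative_of_ratio]).

    For P, Q of bounded size this is the solvability of a homogeneous linear system in finitely many
    unknowns, that is, the vanishing of its maximal minors ([has_kernelP]). If it fails over K for a
    pair (m, m'), one nonzero element of R witnesses the failure modulo every prime that avoids it
    ([pade_obstruction]). In a Dedekind domain a nonzero element lies in finitely many primes, so
    some p in S avoids all these witnesses and a coefficient of the given relation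
    ([infinite_primes_avoid]).

    Modulo this p the congruences, iterated, say that g_i^(q-1) is a quotient of polynomials of
    degree O(q) ([lucas_reduction]). A linear relation between such radicals makes two of them
    proportional over k(x) ([kummer]), because a quotient z with z^q = z is constant
    ([frobenius_proportional]). Extracting the (q-1)-st root of the height bound
    ([poly_ratio_bound], [pade_kernel]) shows that the ratio solves the reduced system, whose size
    does not depend on p. Hence the system over K is solvable too, and [pade_kernel_ratfun] reads P
    and Q off a solution. *)

Section Fractions.
Local Open Scope quotient_scope.

Lemma fractionP (R : idomainType) (z : {fraction R}) :
  exists a b : R, b != 0 /\ z = FracField.tofrac a / FracField.tofrac b.
Proof.
elim/quotW: z => r; exists (\n_r), (\d_r).
have d0 := denom_ratioP r; split=> //.
apply: (canRL (mulfK _)); first by rewrite tofrac_eq0.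
apply/eqP; rewrite -[(_ * _)%R]/(FracField.mul _ _) !piE FracField.equivfE.
by rewrite !numden_Ratio ?mulf_neq0 ?oner_neq0 // !mulr1 mulrC.
Qed.

Lemma common_denominator (R : idomainType) (J : finType) (x : J -> {fraction R}) :
  exists2 b : R, b != 0 &
    exists y : J -> R, forall j, FracField.tofrac b * x j = FracField.tofrac (y j).
Proof.
have fr j : exists ab : R * R,
    ab.2 != 0 /\ x j = FracField.tofrac ab.1 / FracField.tofrac ab.2.
  by have [a [b [b0 ->]]] := fractionP (x j); exists (a, b).
have [F FP] := choice fr.
exists (\prod_j (F j).2); first by apply/prodf_neq0 => j _; case: (FP j).
exists (fun j => (F j).1 * \prod_(i | i != j) (F i).2) => j.
have [b0 ->] := FP j; rewrite (bigD1 j) //= !rmorphM /= [X in X * _]mulrC.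
by rewrite -mulrA [FracField.tofrac (F j).2 * _]mulrC divfK ?tofrac_eq0 // mulrC.
Qed.

End Fractions.

(** * Primes avoiding an element of a Dedekind domain *)

(** [noetherian] speaks of bundled boolean ideals; classical truth values turn a proper set closed
    under linear combinations into one. *)
Lemma finitely_generated (R : idomainType) (I : set R) :
  noetherian R -> I 0 -> ~ I 1 ->
  (forall a x y, I x -> I y -> I (a * x + y)) ->
  exists s : seq R, (forall x, x \in s -> I x) /\
    forall x, I x -> exists c : 'I_(size s) -> R, x = \sum_i c i * s`_i.
Proof.
move=> noeth I0 I1 Ilin.
pose P : pred R := fun x => `[< I x >].
have clP : idealr_closed P.
  split; first exact/asboolP.
  - by apply/negP => /asboolP.
  - by move=> a x y /asboolP Ix /asboolP Iy; apply/asboolP; apply: Ilin.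
pose J : idealr R := HB.pack_for (idealr R) P (isIdealr.Build R P clP).
have [s sP] := noeth J; exists s; split=> [x xs|x Ix].
  suff : x \in J by move/asboolP.
  apply/sP; have xs' : (index x s < size s)%N by rewrite index_mem.
  exists (fun i => (i == Ordinal xs')%:R).
  rewrite (bigD1 (Ordinal xs')) //= eqxx mul1r nth_index // big1 ?addr0 //.
  by move=> i /negPf ->; rewrite mul0r.
by apply/sP; apply/asboolP.
Qed.

Lemma noetherian_chain (R : idomainType) (I : nat -> set R) :
  noetherian R -> (forall k, I k 0) -> (forall k, ~ I k 1) ->
  (forall k a x y, I k x -> I k y -> I k (a * x + y)) ->
  (forall k, I k `<=` I k.+1) ->
  exists k, I k.+1 `<=` I k.
Proof.
move=> noeth I0 I1 Ilin Imono.
have Ile k l : (k <= l)%N -> I k `<=` I l.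
  move=> /subnKC <-; elim: (l - k)%N => [|m IH]; first by rewrite addn0.
  by rewrite addnS; apply: subset_trans IH (Imono _).
have [||a x y [k Ikx] [l Ily]|s [sI Is]] :=
    @finitely_generated R [set x | exists k, I k x] noeth.
- by exists 0%N.
- by case=> k /I1.
- exists (maxn k l); apply: Ilin.
    by apply: Ile Ikx; rewrite leq_maxl.
  by apply: Ile Ily; rewrite leq_maxr.
have [N sN] : exists N, forall x, x \in s -> I N x.
  elim: s sI {Is} => [|y s IH] sI; first by exists 0%N.
  have [k Iky] := sI y (mem_head _ _).
  have [x xs|N sN] := IH; first by apply: sI; rewrite inE xs orbT.
  exists (maxn k N) => x; rewrite inE => /predU1P[->|/sN].
    by apply: Ile Iky; rewrite leq_maxl.
  by apply: Ile; rewrite leq_maxr.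
exists N => x IN1; have [|c ->] := Is x; first by exists N.+1.
elim/big_ind: _ => [|y z Iy Iz|i _]; first exact: I0.
  by rewrite -[y]mul1r; apply: Ilin.
by rewrite -[_ * _]addr0; apply: Ilin => //; apply/sN/mem_nth.
Qed.

(* For an infinite set T of primes maximizing the intersection of T, that     *)
(* intersection is prime: if x * y belongs to it, then x or y belongs to      *)
(* infinitely many members of T.                                              *)
Lemma infinite_primes_avoid (R : idomainType) (S : set (prime_idealr R))
    (c : R) : dedekind R -> infinite_set S -> c != 0 ->
  exists2 p : prime_idealr R, S p & c \notin p.
Proof.
move=> [noeth _ maxl] infS c0; apply: contrapT => noavoid.
have cS p : S p -> c \in p.
  by move=> Sp; apply: contrapT => cp; apply: noavoid; exists p => //; apply/negP.
pose I (T : set (prime_idealr R)) : set R := [set x | forall p, T p -> x \in p].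
have infN0 (T : set (prime_idealr R)) : infinite_set T -> exists p, T p.
  move=> infT; apply: contrapT => T0; apply: infT.
  suff -> : T = set0 by exact: finite_set0.
  by apply/seteqP; split=> // p Tp; apply: T0; exists p.
pose good T := infinite_set T /\ T `<=` S.
have [T [infT TS] Tmax] : exists2 T, good T &
    forall T', infinite_set T' -> T' `<=` T -> I T' `<=` I T.
  (* Otherwise every good set has a good subset with strictly larger intersection, and iterated
     choice builds a strictly increasing chain of ideals. *)
  apply: contrapT => nomax.
  have step (T : {T | good T}) : {T' : {T | good T} |
      sval T' `<=` sval T /\ ~ (I (sval T') `<=` I (sval T))}.
    apply: cid; case: T => T gT /=; apply: contrapT => nT; apply: nomax.
    exists T => // T' infT' T'T; apply: contrapT => nI; apply: nT.
    have gT' : good T' by split=> //; apply: subset_trans T'T gT.2.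
    by exists (exist _ T' gT').
  pose T k := iter k (fun T => sval (step T)) (exist good S (conj infS (@subset_refl _ S))).
  have TP k : sval (T k.+1) `<=` sval (T k) /\
      ~ (I (sval (T k.+1)) `<=` I (sval (T k))).
    by rewrite /T /=; case: (step _).
  have [||||k] := @noetherian_chain R (fun k => I (sval (T k))) noeth.
  - by move=> k p _; exact: idealr0.
  - move=> k I1; have [p Tp] := infN0 _ (svalP (T k)).1.
    by have := I1 p Tp; rewrite idealr1.
  - move=> k a x y Ix Iy p Tp.
    by rewrite rpredD ?idealMr ?Ix ?Iy.
  - by move=> k x Ix p Tp; apply: Ix; apply: (TP k).1.
  by move/(TP k).2.
pose P : pred R := fun x => `[< I T x >].
have clP : idealr_closed P.
  split; first by apply/asboolP => p _; exact: idealr0.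
    apply/negP => /asboolP I1; have [p Tp] := infN0 _ infT.
    by have := I1 p Tp; rewrite idealr1.
  move=> a x y /asboolP Ix /asboolP Iy; apply/asboolP => p Tp.
  by rewrite rpredD ?idealMr ?Ix ?Iy.
have prP : prime_idealr_closed P.
  move=> x y /asboolP Ixy.
  pose A z := T `&` [set p : prime_idealr R | z \in p].
  have [fx|ifx] := pselect (finite_set (A x)); last first.
    apply/orP; left; apply/asboolP; apply: (Tmax (A x) ifx).
      by move=> p [].
    by move=> p [].
  have [fy|ify] := pselect (finite_set (A y)); last first.
    apply/orP; right; apply/asboolP; apply: (Tmax (A y) ify).
      by move=> p [].
    by move=> p [].
  case: infT; apply: (@sub_finite_set _ _ (A x `|` A y)).
    move=> p Tp; have := Ixy p Tp; rewrite prime_idealrM.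
    by case/orP => h; [left|right].
  by rewrite finite_setU.
pose J : prime_idealr R := HB.pack_for (prime_idealr R) P
  (isIdealr.Build R P clP) (isPrimeIdealrClosed.Build R P prP).
(* The intersection contains [c], so it is a nonzero prime, hence maximal. It lies in every member
   of [T] and so equals each of them, which leaves at most one member. *)
have JT p : T p -> J = p.
  move=> Tp; apply: prime_idealr_inj => x.
  have Jp : {subset J <= p} by move=> z /asboolP; apply.
  apply/idP/idP; first exact: Jp.
  apply: (maxl J) => //; exists c => //.
  by apply/asboolP => q Tq; apply/cS/TS.
apply: infT; apply: (@sub_finite_set _ _ [set J]); last exact: finite_set1.
by move=> p /JT <-.
Qed.

(** * Kernels and minors *)

(* The rows are indexed by an arbitrary type: take finitely many of them with *)
(* maximal rank; all the others are linear combinations of those.             *)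
Lemma kernel_vector_minors (E : fieldType) (T : Type) (c : nat)
    (M : T -> 'rV[E]_c) :
  (forall r : 'I_c -> T, \det (\matrix_i M (r i)) = 0) ->
  exists2 x : 'cV[E]_c, x != 0 & forall t, M t *m x = 0.
Proof.
move=> det0.
pose P k := `[< exists n (r : 'I_n -> T), \rank (\matrix_i M (r i)) = k >].
have P0 : exists k, P k.
  exists 0%N; apply/asboolP; exists 0%N, (fun i : 'I_0 => match notF (ltn_ord i) with end).
  by apply/eqP; rewrite mxrank_eq0; apply/eqP/flatmx0.
have Pc k : P k -> (k <= c)%N.
  by move=> /asboolP[n [r <-]]; apply: rank_leq_col.
have [k /asboolP[n [r rk]] kmax] := ex_maxnP P0 Pc.
set A := \matrix_i M (r i) in rk.
have [fullA|nfullA] := boolP (row_full A).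
  have := det0 (r \o fullrankfun fullA).
  have -> : \matrix_i M ((r \o fullrankfun fullA) i) = rowsub (fullrankfun fullA) A.
    by apply/row_matrixP => i; rewrite row_rowsub !rowK.
  by move/eqP; rewrite -[_ == 0]negbK -unitfE -unitmxE fullrowsub_unit.
have ker0 : kermx A^T != 0.
  by rewrite kermx_eq0 /row_free mxrank_tr.
have /rowV0Pn[x xk x0] := ker0.
exists x^T; first by rewrite -(inj_eq trmx_inj) trmxK trmx0.
move=> t.
have tA : (M t <= A)%MS.
  pose r' (i : 'I_(1 + n)) := if fintype.split i is inr j then r j else t.
  have rE : \matrix_i M (r' i) = col_mx (M t) A.
    apply/row_matrixP => i; rewrite rowK /r' -[in RHS](splitK i).
    case: (fintype.split i) => j /=; first by rewrite rowKu ord1 row_id.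
    by rewrite rowKd rowK.
  have le : (\rank (M t + A)%MS <= \rank A)%N.
    rewrite rk; apply: kmax; apply/asboolP; exists (1 + n)%N, r'.
    by rewrite rE addsmxE.
  have /eqmxP/andP[_] : (A :=: (M t + A)%MS)%MS.
    apply/eqmxP; rewrite addsmxSr /=.
    by rewrite -(geq_leqif (mxrank_leqif_sup (addsmxSr (M t) A))).
  by apply: submx_trans; apply: addsmxSl.
have [D ->] := submxP tA.
rewrite -mulmxA; suff -> : A *m x^T = 0 by rewrite mulmx0.
apply: trmx_inj; rewrite trmx_mul trmxK trmx0; exact/sub_kermxP.
Qed.

Lemma kernel_vector_det0 (E : fieldType) (T : Type) (c : nat)
    (M : T -> 'rV[E]_c) (x : 'cV[E]_c) (r : 'I_c -> T) :
  x != 0 -> (forall t, M t *m x = 0) -> \det (\matrix_i M (r i)) = 0.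
Proof.
move=> x0 Mx; apply/eqP; apply: contraNT x0; rewrite -unitfE -unitmxE => u.
rewrite -[x](mulKmx u); suff -> : (\matrix_i M (r i)) *m x = 0 by rewrite mulmx0.
by apply/row_matrixP => i; rewrite row_mul rowK Mx row0.
Qed.

(** There may be infinitely many rows: they stand for the coefficients of an identity between
    series, the columns for the unknown coefficients of polynomials. *)
Definition has_kernel (E : nzRingType) (T : Type) (J : finType) (M : T -> J -> E) :=
  exists x : J -> E, (exists j, x j != 0) /\ forall t, \sum_j M t j * x j = 0.

Definition maximal_minor (R : comNzRingType) (T : Type) (J : finType) (M : T -> J -> R)
    (r : 'I_#|J| -> T) : R :=
  \det (\matrix_(i, j) M (r i) (enum_val j)).

Lemma map_maximal_minor (A B : comNzRingType) (h : {rmorphism A -> B}) (T : Type)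
    (J : finType) (M : T -> J -> A) r :
  h (maximal_minor M r) = maximal_minor (fun t j => h (M t j)) r.
Proof.
rewrite -det_map_mx; congr (\det _).
by apply/matrixP => i j; rewrite !mxE.
Qed.

Lemma has_kernelP (E : fieldType) (T : Type) (J : finType) (M : T -> J -> E) :
  has_kernel M <->
  forall r : 'I_#|J| -> T, maximal_minor M r = 0.
Proof.
rewrite /maximal_minor; pose N t : 'rV[E]_#|J| := \row_j M t (enum_val j).
have NE r : \matrix_(i, j) M (r i) (enum_val j) = \matrix_i N (r i).
  by apply/matrixP => i j; rewrite !mxE.
have mulN t (x : 'cV_#|J|) : N t *m x = (\sum_j M t j * x (enum_rank j) 0)%:M.
  rewrite [LHS]mx11_scalar !mxE (reindex_onto (@enum_rank J) enum_val) /=.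
    congr (_%:M); apply: eq_big => j; first by rewrite enum_rankK eqxx.
    by rewrite !mxE enum_rankK.
  by move=> j _; rewrite enum_valK.
split=> [[x [[j0 xj0] Mx]] r|det0].
  rewrite NE; apply: (@kernel_vector_det0 _ _ _ _ (\col_j x (enum_val j))).
    apply/eqP => /colP /(_ (enum_rank j0)) /eqP.
    by rewrite !mxE enum_rankK (negPf xj0).
  move=> t; rewrite mulN; under eq_bigr do rewrite mxE enum_rankK.
  by rewrite Mx; apply/matrixP => i j; rewrite !mxE mul0rn.
have [|x x0 Nx] := @kernel_vector_minors _ T _ N; first by move=> r; rewrite -NE.
exists (fun j => x (enum_rank j) 0); split.
  apply: contrapT => nx; case/eqP: x0; apply/colP => j; rewrite mxE.
  apply/eqP; apply: contrapT => /negP xj; apply: nx.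
  by exists (enum_val j); rewrite enum_valK.
move=> t; have := Nx t; rewrite mulN => /matrixP /(_ 0 0).
by rewrite !mxE eqxx mulr1n.
Qed.

(** A kernel vector over [K] has no evident reduction to [k], but the minors live in [A]: zero in
    [K], they are zero in [A] by injectivity, hence in [k]. *)
Lemma has_kernel_map (A : comNzRingType) (K k : fieldType)
    (iota : {rmorphism A -> K}) (pi : {rmorphism A -> k})
    (T : Type) (J : finType) (M : T -> J -> A) :
  injective iota ->
  has_kernel (fun t j => iota (M t j)) -> has_kernel (fun t j => pi (M t j)).
Proof.
move=> inj_iota /has_kernelP det0; apply/has_kernelP => r.
have := det0 r; rewrite -!map_maximal_minor => e.
have -> : maximal_minor M r = 0 by apply: inj_iota; rewrite e rmorph0.
exact: rmorph0.
Qed.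

(** * Power series *)

Section MpsMorphisms.
Variable d : nat.

Lemma mps_coef_sum (R : zmodType) (I : Type) (r : seq I) (P : pred I)
    (F : I -> mps d R) m :
  (\sum_(i <- r | P i) F i) m = \sum_(i <- r | P i) F i m.
Proof. by elim/big_rec2: _ => // i y1 y2 _ <-. Qed.

Lemma mps_coefM (R : comNzRingType) (f g : mps d R) m :
  (f * g) m = \sum_(k : 'X_{1..d < (mdeg m).+1, (mdeg m).+1}
                   | m == (k.1 + k.2)%MM) f k.1 * g k.2.
Proof. by []. Qed.

Lemma mps_coef1 (R : comNzRingType) m : (1 : mps d R) m = (m == 0%MM)%:R.
Proof. by []. Qed.

Lemma mps_coef0M (R : comNzRingType) (f g : mps d R) :
  (f * g) 0%MM = f 0%MM * g 0%MM.
Proof.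
rewrite mps_coefM.
have lt0 : (mdeg (0%MM : 'X_{1..d}) < (mdeg (0%MM : 'X_{1..d})).+1)%N by [].
rewrite (bigD1 (BMultinom lt0, BMultinom lt0)) /= ?addm0 // big1 ?addr0 //.
move=> [[k1 /= h1] [k2 /= h2]]; rewrite eq_sym mnmD_eq0 => /andP[/andP[/eqP e1 /eqP e2]].
by rewrite xpair_eqE -!val_eqE /= e1 e2 eqxx.
Qed.

Lemma mps_coef0X (R : comNzRingType) (f : mps d R) n :
  (f ^+ n) 0%MM = f 0%MM ^+ n.
Proof. by elim: n => [|n IH]; rewrite ?expr0 ?mps_coef1 ?eqxx // !exprS mps_coef0M IH. Qed.

Lemma mps_coef0_prod (R : comNzRingType) (I : Type) (r : seq I) (P : pred I)
    (F : I -> mps d R) :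
  (\prod_(i <- r | P i) F i) 0%MM = \prod_(i <- r | P i) F i 0%MM.
Proof.
elim/big_rec2: _ => [|i y1 y2 _ <-]; first by rewrite mps_coef1 eqxx.
by rewrite mps_coef0M.
Qed.

Definition mps_map (A B : Type) (h : A -> B) (f : mps d A) : mps d B :=
  MPs (fun m => h (f m)).

Section Map.
Variables (A B : comNzRingType) (h : {rmorphism A -> B}).

Fact mps_map_is_zmod_morphism : zmod_morphism (mps_map h).
Proof. by move=> f g; apply/mpsP => m /=; rewrite rmorphB. Qed.

Fact mps_map_is_monoid_morphism : monoid_morphism (mps_map h).
Proof.
split; first by apply/mpsP => m /=; rewrite rmorph_nat.
move=> f g; apply/mpsP => m /=; rewrite rmorph_sum.
by apply: eq_bigr => k _; rewrite rmorphM.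
Qed.

HB.instance Definition _ := GRing.isZmodMorphism.Build (mps d A) (mps d B)
  (mps_map h) mps_map_is_zmod_morphism.
HB.instance Definition _ := GRing.isMonoidMorphism.Build (mps d A) (mps d B)
  (mps_map h) mps_map_is_monoid_morphism.
End Map.

Variable K : fieldType.
Implicit Types (f g : mps d K) (A B : {mpoly K[d]}).

Fact mps_of_mpoly_is_zmod_morphism : zmod_morphism (@mps_of_mpoly d K).
Proof. by move=> A B; apply/mpsP => m /=; rewrite mcoeffB. Qed.

Fact mps_of_mpoly_is_monoid_morphism : monoid_morphism (@mps_of_mpoly d K).
Proof.
split; first by apply/mpsP => m /=; rewrite mcoeff1.
by move=> A B; apply/mpsP => m /=; rewrite mcoeffM.
Qed.

HB.instance Definition _ := GRing.isZmodMorphism.Build {mpoly K[d]} (mps d K)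
  (@mps_of_mpoly d K) mps_of_mpoly_is_zmod_morphism.
HB.instance Definition _ := GRing.isMonoidMorphism.Build {mpoly K[d]} (mps d K)
  (@mps_of_mpoly d K) mps_of_mpoly_is_monoid_morphism.

Lemma mps_of_mpoly_inj : injective (@mps_of_mpoly d K).
Proof. by move=> A B AB; apply/mpolyP => m; move/mpsP: AB => /(_ m). Qed.

Lemma mps_of_mpoly_eq0 A : (mps_of_mpoly A == 0) = (A == 0).
Proof. by rewrite -(inj_eq mps_of_mpoly_inj) rmorph0. Qed.

Lemma mps_coefCM (c : K) f m : (mps_of_mpoly c%:MP * f) m = c * f m.
Proof.
rewrite mps_coefM.
have lt0 : (mdeg (0%MM : 'X_{1..d}) < (mdeg m).+1)%N by rewrite mdeg0.
have ltm : (mdeg m < (mdeg m).+1)%N by [].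
rewrite (bigD1 (BMultinom lt0, BMultinom ltm)) /= ?add0m ?eqxx //.
rewrite mcoeffC eqxx mulr1 big1 ?addr0 //.
move=> [[k1 /= h1] [k2 /= h2]] /andP[/eqP em ne]; rewrite mcoeffC.
case: eqP => [k10|_]; last by rewrite mulr0 mul0r.
case/eqP: ne; congr pair; apply: val_inj => //=.
by rewrite em k10 add0m.
Qed.

Definition mps_trunc N f : {mpoly K[d]} := \sum_(m : 'X_{1..d < N}) f m *: 'X_[m].

Lemma mps_truncE N f m : (mdeg m < N)%N -> (mps_trunc N f)@_m = f m.
Proof.
move=> lt_mN; rewrite raddf_sum /= (bigD1 (BMultinom lt_mN)) //=.
rewrite mcoeffZ mcoeffX eqxx mulr1 big1 ?addr0 // => k ne_k.
rewrite mcoeffZ mcoeffX; case: eqP => [e|_]; last by rewrite mulr0.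
by case/eqP: ne_k; apply/val_inj.
Qed.

(** Moves powers of series to the polynomial ring, where Frobenius expands the power of a finite
    sum. *)
Lemma mps_coefX_trunc n f m :
  (f ^+ n) m = (mps_trunc (mdeg m).+1 f ^+ n)@_m.
Proof.
suff key N k : (mdeg k < N)%N -> (f ^+ n) k = (mps_trunc N f ^+ n)@_k by exact: key.
elim: n k => [|n IH] k lt_k; first by rewrite !expr0 mcoeff1.
rewrite !exprS mps_coefM mcoeffM; apply: eq_bigr => -[[k1 /= h1] [k2 /= h2]] _.
by rewrite mps_truncE ?IH //; apply: leq_trans lt_k.
Qed.

(** The lowest exponent for the monomial order is additive on products and plays the part of a
    valuation. *)
Definition lowest f m := f m != 0 /\ forall k, f k != 0 -> (m <= k)%O.

Lemma lowest_exists f : f != 0 -> exists m, lowest f m.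
Proof.
move=> nz_f; have [m nz_m] : exists m, f m != 0.
  apply: contrapT => nf; case/eqP: nz_f; apply/mpsP => m /=.
  by apply/eqP; apply: contrapT => /negP nz; apply: nf; exists m.
elim/(well_founded_ind (@ltom_wf d)): m nz_m => m IH nz_m.
have [[k nz_k lt_km]|no] := pselect (exists2 k, f k != 0 & (k < m)%O).
  exact: IH lt_km nz_k.
exists m; split=> // k nz_k; rewrite leNgt; apply/negP => lt_km.
by apply: no; exists k.
Qed.

Lemma lowestM f g m n : lowest f m -> lowest g n ->
  lowest (f * g) (m + n)%MM /\ (f * g) (m + n)%MM = f m * g n.
Proof.
move=> [nz_m le_m] [nz_n le_n].
have coefE : (f * g) (m + n)%MM = f m * g n.
  have lt_m : (mdeg m < (mdeg (m + n)%MM).+1)%N by rewrite mdegD ltnS leq_addr.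
  have lt_n : (mdeg n < (mdeg (m + n)%MM).+1)%N by rewrite mdegD ltnS leq_addl.
  rewrite mps_coefM (bigD1 (BMultinom lt_m, BMultinom lt_n)) //= big1 ?addr0 //.
  move=> [[k1 /= h1] [k2 /= h2]] /andP[/eqP e ne].
  apply/eqP/negPn; rewrite mulf_eq0 negb_or; apply/negP => /andP[nz1 nz2].
  have := le_m _ nz1; rewrite le_eqVlt => /predU1P[e1|lt1]; last first.
    have: ((m + n)%MM < (k1 + k2)%MM)%O.
      by apply: ltmc_le_add => //; apply: le_n.
    by rewrite e ltxx.
  by subst k1; have e2 := addmI e; subst k2; case/eqP: ne; congr pair; apply: val_inj.
split=> //; split; first by rewrite coefE mulf_neq0.
move=> k; rewrite mps_coefM; apply: contraNT; rewrite -ltNge => lt_k.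
rewrite big1 // => -[[k1 /= h1] [k2 /= h2]] /eqP ek.
apply/eqP/negPn; rewrite mulf_eq0 negb_or; apply/negP => /andP[nz1 nz2].
have := lem_add (le_m _ nz1) (le_n _ nz2).
by rewrite -ek leNgt lt_k.
Qed.

Lemma lowestX f m n : lowest f m ->
  lowest (f ^+ n) (m *+ n)%MM /\ (f ^+ n) (m *+ n)%MM = f m ^+ n.
Proof.
move=> fm; elim: n => [|n [IH1 IH2]].
  rewrite !expr0 mulm0n mps_coef1 eqxx; split=> //; split.
    by rewrite mps_coef1 eqxx oner_neq0.
  by move=> k _; exact: le0m.
have [h1 h2] := lowestM fm IH1.
by rewrite mulmS !exprS h2 IH2.
Qed.

Lemma lowest_uniq f m n : lowest f m -> lowest f n -> m = n.
Proof.
by move=> [fm lem] [fn len]; apply: le_anti; rewrite lem // len.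
Qed.

Lemma pchar_mpoly p : p \in [pchar K] -> p \in [pchar {mpoly K[d]}].
Proof. exact: (rmorph_pchar (mpolyC d (R := K))). Qed.

Lemma pchar_mps p : p \in [pchar K] -> p \in [pchar mps d K].
Proof.
by move=> /pchar_mpoly; exact: (rmorph_pchar (@mps_of_mpoly d K)).
Qed.

Lemma mps_frobenius p j f : p \in [pchar K] ->
  f ^+ (p ^ j) = mps_subst_pow (p ^ j) (mps_map (fun y => y ^+ (p ^ j)) f).
Proof.
move=> pK; set q := (p ^ j)%N.
have q_gt0 : (0 < q)%N by rewrite expn_gt0 prime_gt0 // (pcharf_prime pK).
have natq : [pchar {mpoly K[d]}].-nat q.
  have pM := pchar_mpoly pK; rewrite (eq_pnat _ (pcharf_eq pM)) /q.
  by rewrite pnatX pnat_id ?(pcharf_prime pK).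
apply/mpsP => m; rewrite mps_coefX_trunc /mps_trunc.
rewrite (big_morph (fun x => x ^+ q) (fun x y => exprDn_pchar x y natq) (expr0n _ q)).
rewrite (negPf (lt0n_neq0 q_gt0)) raddf_sum /=.
under eq_bigr do rewrite exprZn mcoeffZ mpolyXn mcoeffX.
case: forallP => [dv|ndv].
  set k := [multinom _ | _ < _].
  have mE : m = (k *+ q)%MM.
    by apply/mnmP => i; rewrite mulmnE mnmE divnK //; apply: dv.
  have lt_k : (mdeg k < (mdeg m).+1)%N.
    by rewrite ltnS mE mdegMn leq_pmulr.
  rewrite (bigD1 (BMultinom lt_k)) //= -mE eqxx mulr1 big1 ?addr0 // => l ne.
  case: eqP => [e|_]; last by rewrite mulr0.
  case/eqP: ne; apply/val_inj/mnmP => i /=; apply/eqP.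
  by rewrite -(eqn_pmul2r q_gt0) -!mulmnE e mE.
rewrite big1 // => l _; case: eqP => [e|_]; last by rewrite mulr0.
by case: ndv => i; rewrite -e mulmnE dvdn_mull.
Qed.

(** The quotient z = f / g satisfies z^q = z. Lowest exponents m of f and n of g satisfy (q - 1) m =
    (q - 1) n, so they agree. Let c be the quotient of the lowest coefficients. As c^q = c, the
    difference f - c * g satisfies the same equation with g; if it were nonzero, its lowest exponent
    would be m again, where its coefficient is zero. *)
Lemma frobenius_proportional p j f g : p \in [pchar K] -> (0 < j)%N ->
  (forall y : K, y ^+ (p ^ j) = y) -> f != 0 -> g != 0 ->
  g ^+ (p ^ j) * f = f ^+ (p ^ j) * g ->
  exists2 c : K, c != 0 & f = mps_of_mpoly c%:MP * g.
Proof.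
move=> pK j_gt0 fixK; set q := (p ^ j)%N.
have q_gt1 : (1 < q)%N.
  by rewrite -(expn0 p) ltn_exp2l // prime_gt1 // (pcharf_prime pK).
have key u v m n : lowest u m -> lowest v n -> v ^+ q * u = u ^+ q * v -> m = n.
  move=> um vn e.
  have [uq _] := lowestX q um; have [vq _] := lowestX q vn.
  have [h1 _] := lowestM vq um; have [h2 _] := lowestM uq vn.
  rewrite e in h1; have /mnmP e' := lowest_uniq h1 h2.
  apply/mnmP => i; have := e' i; rewrite !mnmDE !mulmnE.
  case: q q_gt1 {uq vq h1 h2 e e'} => // [[|r]] // _; rewrite ![(_ * r.+2)%N]mulnS.
  rewrite addnAC [RHS]addnAC [(n i + m i)%N]addnC => /addnI /eqP.
  by rewrite eqn_pmul2r // => /eqP.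
move=> nzf nzg e.
have [m fm] := lowest_exists nzf; have [n gn] := lowest_exists nzg.
have mn := key _ _ _ _ fm gn e; subst n.
set c := f m / g m; have c0 : c != 0.
  by rewrite mulf_neq0 ?invr_neq0 ?fm.1 ?gn.1.
exists c => //; set C := mps_of_mpoly _.
have Cq : C ^+ q = C by rewrite -!rmorphXn /= fixK.
apply/eqP; rewrite -subr_eq0; apply/negPn/negP => nzz.
have [n zn] := lowest_exists nzz.
have natq : [pchar mps d K].-nat q.
  have pM := pchar_mps pK; rewrite (eq_pnat _ (pcharf_eq pM)) /q.
  by rewrite pnatX pnat_id ?(pcharf_prime pK).
have nm : n = m.
  apply: (key _ _ _ _ zn gn).
  rewrite (exprDn_pchar _ _ natq) (exprNn_pchar _ natq) exprMn Cq mulrBr e mulrBl.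
  by congr (_ - _); rewrite mulrCA mulrA.
case: zn => /negP[]; subst n => /=.
rewrite [X in _ - X]mps_coefCM /c divfK ?subrr //; exact: gn.1.
Qed.

End MpsMorphisms.

(** * Quotients of monomials in positive characteristic *)

Lemma cross_multiply (T : comNzRingType) (U c1 c2 d1 d2 u1 u2 w1 w2 V1 V2 : T) :
  V1 * u1 = U * w1 -> V2 * u2 = U * w2 -> d2 * V2 * c1 = d1 * V1 * c2 ->
  U * (d2 * w2 * (c1 * u1)) = U * (d1 * w1 * (c2 * u2)).
Proof.
move=> e1 e2 e.
rewrite [LHS](AC (1*(2*2)) ((1*3)*2*(4*5))) [RHS](AC (1*(2*2)) ((1*3)*2*(4*5))) /=.
rewrite -e1 -e2 [LHS](AC (2*1*2) ((3*1*4)*(2*5))) [RHS](AC (2*1*2) ((3*1*4)*(5*2))) /=.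
by rewrite e.
Qed.

Section Kummer.
Variables (d : nat) (K : fieldType) (p j : nat).
Hypotheses (pK : p \in [pchar K]) (j_gt0 : (0 < j)%N).
Hypothesis fixK : forall y : K, y ^+ (p ^ j) = y.
Local Notation q := (p ^ j)%N.
Local Notation "A %:S" := (mps_of_mpoly A) (at level 2, format "A %:S").
Implicit Types (A B P Q U V : {mpoly K[d]}) (g u : mps d K).

(* Raising a shortest relation to the q-th power gives a relation with the    *)
(* same support, hence a proportional one; so two of its terms have a ratio   *)
(* z with z ^ q = z.                                                          *)
Lemma kummer_common (I : eqType) (s : seq I) (c V : I -> {mpoly K[d]}) U
    (u : I -> mps d K) :
  uniq s -> s != [::] -> U != 0 ->
  (forall i, i \in s -> c i != 0) -> (forall i, i \in s -> u i != 0) ->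
  (forall i, i \in s -> (V i)%:S * u i = U%:S * u i ^+ q) ->
  \sum_(i <- s) (c i)%:S * u i = 0 ->
  exists i1 i2 P Q, [/\ i1 \in s, i2 \in s, i1 != i2, P != 0 /\ Q != 0
    & P%:S * u i1 = Q%:S * u i2].
Proof.
have p_pr := pcharf_prime pK.
have q_gt0 : (0 < q)%N by rewrite expn_gt0 prime_gt0.
have natq : [pchar mps d K].-nat q.
  have pM := @pchar_mps d _ _ pK; rewrite (eq_pnat _ (pcharf_eq pM)).
  by rewrite pnatX pnat_id.
elim: (size s) {-2}s (leqnn (size s)) c => {s} [|N IH] s le_s c us ns U0 c0 u0 Vu rel.
  by case: s le_s ns {us c0 u0 Vu rel}.
case: s le_s us ns c0 u0 Vu rel => // i1 s le_s us _ c0 u0 Vu rel.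
have c1 := c0 _ (mem_head _ _); have u1 := u0 _ (mem_head _ _).
have relq : \sum_(i <- i1 :: s) (c i ^+ q * V i)%:S * u i = 0.
  transitivity (U%:S * (\sum_(i <- i1 :: s) (c i)%:S * u i) ^+ q); last first.
    by rewrite rel expr0n (gtn_eqF q_gt0) mulr0.
  rewrite (big_morph (fun x => x ^+ q) (fun x y => exprDn_pchar x y natq) (expr0n _ q)).
  rewrite (gtn_eqF q_gt0) mulr_sumr big_seq [RHS]big_seq; apply: eq_bigr => i si.
  by rewrite rmorphM rmorphXn /= -mulrA Vu // exprMn mulrCA.
(* This combination of the relation and its q-th power cancels the term of [i1]. Either a shorter
   nontrivial relation remains, or all [e i] vanish and the first two terms satisfy the hypothesis
   of [frobenius_proportional]. *)
pose e i := c i ^+ q * V i * c i1 - c i1 ^+ q * V i1 * c i.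
have rele : \sum_(i <- i1 :: s) (e i)%:S * u i = 0.
  transitivity ((c i1)%:S * (\sum_(i <- i1 :: s) (c i ^+ q * V i)%:S * u i)
      - (c i1 ^+ q * V i1)%:S * (\sum_(i <- i1 :: s) (c i)%:S * u i)).
    rewrite !mulr_sumr -sumrB; apply: eq_bigr => i _.
    rewrite rmorphB !(rmorphM (@mps_of_mpoly d K)) /= mulrBl !mulrA; congr (_ - _).
    by congr (_ * _); rewrite mulrC mulrA.
  by rewrite rel relq !mulr0 subrr.
have e1 : e i1 = 0 by rewrite /e subrr.
rewrite big_cons e1 rmorph0 mul0r add0r in rele.
have [alle|nalle] := boolP (all (fun i => e i == 0) s); last first.
  pose s' := [seq i <- s | e i != 0].
  have sub_s' i : i \in s' -> i \in i1 :: s.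
    by rewrite mem_filter inE => /andP[_ ->]; rewrite orbT.
  have [||||||||k1 [k2 [P [Q [h1 h2 h3 h4 h5]]]]] := IH s' _ e; last first.
  - by exists k1, k2, P, Q; split=> //; apply: sub_s'.
  - rewrite big_filter -[RHS]rele [RHS](bigID (fun i => e i != 0)) /=.
    by rewrite [X in _ + X]big1 ?addr0 // => i; rewrite negbK => /eqP ->;
      rewrite rmorph0 mul0r.
  - by move=> i /sub_s'; apply: Vu.
  - by move=> i /sub_s'; apply: u0.
  - by move=> i; rewrite mem_filter => /andP[].
  - by [].
  - by rewrite -has_filter has_predC.
  - by apply: filter_uniq; case/andP: us.
  - by rewrite -ltnS (leq_trans _ le_s) // ltnS size_filter count_size.
case: s le_s us c0 u0 Vu rel relq rele alle => [|i2 s] le_s us c0 u0 Vu rel relq rele alle.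
  move: rel; rewrite big_seq1 => /eqP; rewrite mulf_eq0 mps_of_mpoly_eq0.
  by rewrite (negPf c1) (negPf u1).
have i2s : i2 \in i1 :: i2 :: s by rewrite !inE eqxx orbT.
have c2 := c0 _ i2s; have u2 := u0 _ i2s.
have /andP[/eqP e2 _] := alle.
have prop : (c i2)%:S * u i2 != 0 /\ (c i1)%:S * u i1 != 0.
  by split; rewrite mulf_neq0 // mps_of_mpoly_eq0.
have [|b b0 cb] := frobenius_proportional pK j_gt0 fixK prop.2 prop.1.
  have U0' : U%:S != 0 by rewrite mps_of_mpoly_eq0.
  apply: (mulfI U0'); rewrite [in LHS]exprMn [in RHS]exprMn.
  apply: (cross_multiply (Vu _ (mem_head _ _)) (Vu _ i2s)).
  move/eqP: e2; rewrite subr_eq0 => /eqP /(congr1 (@mps_of_mpoly d K)).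
  by rewrite !(rmorphM (@mps_of_mpoly d K)) !(rmorphXn (@mps_of_mpoly d K)).
exists i1, i2, (c i1), (b%:MP * c i2); split=> //; first exact: mem_head.
- by move: us; rewrite /= inE negb_or -andbA => /andP[].
- by split=> //; rewrite mulf_neq0 // mpolyC_eq0.
- by rewrite rmorphM /= -mulrA.
Qed.

(** The quotients V i / U i are brought to a common denominator, which reduces to
    [kummer_common]. *)
Lemma kummer (I : eqType) (s : seq I) (c U V : I -> {mpoly K[d]})
    (u : I -> mps d K) :
  uniq s -> s != [::] ->
  (forall i, i \in s -> c i != 0) -> (forall i, U i != 0) ->
  (forall i, u i != 0) -> (forall i, (V i)%:S * u i = (U i)%:S * u i ^+ q) ->
  \sum_(i <- s) (c i)%:S * u i = 0 ->
  exists i1 i2 P Q, [/\ i1 \in s, i2 \in s, i1 != i2, P != 0 /\ Q != 0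
    & P%:S * u i1 = Q%:S * u i2].
Proof.
move=> us ns c0 U0 u0 Vu; apply: (@kummer_common _ _ _
  (fun i => V i * \prod_(k <- rem i s) U k) (\prod_(k <- s) U k)) => //.
  by rewrite prodf_seq_neq0; apply/allP => i _; rewrite U0.
have SM A B : (A * B)%:S = A%:S * B%:S by exact: rmorphM.
move=> i si; rewrite [\prod_(k <- s) _](big_rem i) //= !SM.
by rewrite mulrAC Vu [RHS]mulrAC.
Qed.

End Kummer.

(** * Rational functions of one variable *)

Section Convolution.
Variable R : comNzRingType.
Implicit Types (P Q : {poly R}) (u v : nat -> R).

(** The n-th coefficient of the product of [P] with the series whose coefficients are [u]: series in
    the auxiliary variable t are kept as sequences. *)
Definition conv P u (n : nat) : R := \sum_(i < n.+1) P`_i * u (n - i)%N.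

Lemma convE P u n N : (n < N)%N -> conv P u n = (P * \poly_(i < N) u i)`_n.
Proof.
move=> lt_nN; rewrite coefM; apply: eq_bigr => i _.
by rewrite coef_poly (leq_ltn_trans (leq_subr _ _) lt_nN).
Qed.

Lemma convM P Q u n : conv (P * Q) u n = conv P (conv Q u) n.
Proof.
rewrite (convE _ _ (ltnSn n)) -mulrA coefM; apply: eq_bigr => i _.
by rewrite (convE _ _ (N := n.+1)) // ltnS leq_subr.
Qed.

Lemma eq_conv P u v : u =1 v -> conv P u =1 conv P v.
Proof. by move=> uv n; apply: eq_bigr => i _; rewrite uv. Qed.

Lemma convB P u v n : conv P (fun i => u i - v i) n = conv P u n - conv P v n.
Proof. by rewrite -sumrB; apply: eq_bigr => i _; rewrite mulrBr. Qed.
End Convolution.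

Lemma conv_eq0 (R : idomainType) (P : {poly R}) (u : nat -> R) :
  P != 0 -> (forall n, conv P u n = 0) -> forall n, u n = 0.
Proof.
move=> P0 Pu.
have exP : exists i, P`_i != 0 by exists (size P).-1; rewrite -lead_coefE lead_coef_eq0.
have [a Pa mina] := ex_minnP exP.
move=> n; elim/ltn_ind: n => n IH.
have := Pu (n + a)%N; rewrite /conv.
have lt_a : (a < (n + a).+1)%N by rewrite ltnS leq_addl.
rewrite (bigD1 (Ordinal lt_a)) //= addnK big1 ?addr0.
  by move/eqP; rewrite mulf_eq0 (negPf Pa) => /eqP.
move=> i ne_i; have [lt_ia|lt_ai|e] := ltngtP i a; last by case/eqP: ne_i; apply/val_inj.
  have [->|nz] := eqVneq P`_i 0; first by rewrite mul0r.
  by have := mina _ nz; rewrite leqNgt lt_ia.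
rewrite IH ?mulr0 // ltn_subLR; last by rewrite -ltnS.
by rewrite [ltnRHS]addnC ltn_add2l.
Qed.

(** After division by the gcd, P'^r and Q'^r are coprime, so P'^r divides R2 and Q'^r divides R1. A
    degree bound N * r on these becomes the bound N on P' and Q'. *)
Lemma poly_ratio_bound (E : fieldType) (P Q R1 R2 : {poly E}) r N :
  P != 0 -> Q != 0 -> R1 != 0 -> R2 != 0 -> (0 < r)%N ->
  P ^+ r * R1 = Q ^+ r * R2 ->
  (size R1 <= (N * r).+1)%N -> (size R2 <= (N * r).+1)%N ->
  exists G P' Q' : {poly E}, [/\ G != 0, P = P' * G, Q = Q' * G &
    (size P' <= N.+1)%N /\ (size Q' <= N.+1)%N].
Proof.
move=> P0 Q0 R10 R20 r_gt0 e s1 s2.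
set G := gcdp P Q; have G0 : G != 0 by rewrite gcdp_eq0 (negPf P0).
pose P' := P %/ G; pose Q' := Q %/ G.
have PE : P = P' * G by rewrite divpK // dvdp_gcdl.
have QE : Q = Q' * G by rewrite divpK // dvdp_gcdr.
have cop : coprimep P' Q' by apply: coprimep_div_gcd; rewrite P0.
have e' : P' ^+ r * R1 = Q' ^+ r * R2.
  apply: (mulfI (expf_neq0 r G0)).
  by rewrite !mulrA ![G ^+ r * _]mulrC -!exprMn -PE -QE.
have key (A B T1 T2 : {poly E}) : coprimep A B -> T2 != 0 -> A ^+ r * T1 = B ^+ r * T2 ->
    (size T2 <= (N * r).+1)%N -> (size A <= N.+1)%N.
  move=> copAB T20 eAB sT2.
  have : A ^+ r %| T2.
    rewrite -(@Gauss_dvdpr _ _ (B ^+ r)); last by rewrite coprimep_expl // coprimep_expr.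
    by rewrite -eAB dvdp_mulr.
  move/(dvdp_leq T20) => le; have := leq_trans le sT2.
  have := size_exp A r; case: (size (A ^+ r)) => [|k] /=.
    move/eqP; rewrite eq_sym muln_eq0 (gtn_eqF r_gt0) orbF => /eqP.
    by case: (size A) => // -[].
  move=> ->; rewrite ltnS leq_pmul2r //.
  by case: (size A).
exists G, P', Q'; split=> //; split; first exact: key e' s2.
by apply: (key Q' P' R2 R1); rewrite // coprimep_sym.
Qed.

(** * Homogeneous parts and linear systems for ratios of series *)

Section Homogeneous.
Variable d : nat.

(** The coefficient of t^j in f(t x_1, ..., t x_d). *)
Definition mps_hom (R : comNzRingType) (f : mps d R) (j : nat) : {mpoly R[d]} :=
  \sum_(m : 'X_{1..d < j.+1} | mdeg m == j) f m *: 'X_[m].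

Section Ring.
Variable R : comNzRingType.
Implicit Types f g : mps d R.

Lemma mps_homE f j m : (mps_hom f j)@_m = if mdeg m == j then f m else 0.
Proof.
rewrite raddf_sum /=; case: eqP => [mj|mj].
  have lt_m : (mdeg m < j.+1)%N by rewrite mj.
  rewrite (bigD1 (BMultinom lt_m)) /= ?mj ?eqxx // big1 ?addr0.
    by rewrite mcoeffZ mcoeffX eqxx mulr1.
  move=> k /andP[_ ne]; rewrite mcoeffZ mcoeffX; case: eqP => [e|_]; last by rewrite mulr0.
  by case/eqP: ne; apply/val_inj.
apply: big1 => k /eqP kj; rewrite mcoeffZ mcoeffX.
by case: eqP => [e|_]; [case: mj; rewrite -e | rewrite mulr0].
Qed.

Lemma mps_homM f g n :
  mps_hom (f * g) n = \sum_(i < n.+1) mps_hom f i * mps_hom g (n - i).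
Proof.
apply/mpolyP => m; rewrite mps_homE mps_coefM raddf_sum /=.
under [RHS]eq_bigr do rewrite mcoeffM.
rewrite exchange_big /=.
case: eqP => [mn|mn]; last first.
  rewrite big1 // => -[[k1 h1] [k2 h2]] /= /eqP e; rewrite big1 // => i _.
  rewrite !mps_homE; case: eqP => [e1|_]; last by rewrite mul0r.
  case: eqP => [e2|_]; last by rewrite mulr0.
  by case: mn; rewrite e mdegD e1 e2 subnKC // -ltnS.
apply: eq_bigr => -[[k1 h1] [k2 h2]] /= /eqP e.
have lt1 : (mdeg k1 < n.+1)%N by rewrite -mn.
rewrite (bigD1 (Ordinal lt1)) //= !mps_homE eqxx -{1}mn e mdegD addKn eqxx.
rewrite big1 ?addr0 // => i ne; rewrite !mps_homE; case: eqP => [e1|_]; last by rewrite mul0r.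
by case/eqP: ne; apply/val_inj.
Qed.

End Ring.

Lemma map_mps_hom (A B : comNzRingType) (h : {rmorphism A -> B}) (f : mps d A) j :
  map_mpoly h (mps_hom f j) = mps_hom (mps_map h f) j.
Proof.
apply/mpolyP => m; rewrite mcoeff_map_mpoly !mps_homE.
by case: ifP => // _; exact: (rmorph0 h).
Qed.

Section Field.
Variable K : fieldType.
Implicit Types (A B P Q : {mpoly K[d]}) (f g u v : mps d K).
Local Notation "A %:S" := (mps_of_mpoly A) (at level 2, format "A %:S").
Local Notation E := {fraction {mpoly K[d]}}.
Local Notation frac := (@FracField.tofrac {mpoly K[d]}).

(* The expansion of A(t * x_1, ..., t * x_d) in powers of t. *)
Definition poly_hom A : {poly {mpoly K[d]}} := \poly_(i < msize A) mps_hom A%:S i.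

Lemma coef_poly_hom A i : (poly_hom A)`_i = mps_hom A%:S i.
Proof.
rewrite coef_poly; case: ltnP => // le_i; apply/esym/mpolyP => m.
rewrite mps_homE mcoeff0; case: eqP => // mi.
by apply: memN_msupp_eq0; apply: msize_mdeg_ge; rewrite mi.
Qed.

Lemma poly_homM A B : poly_hom (A * B) = poly_hom A * poly_hom B.
Proof.
apply/polyP => n; rewrite coef_poly_hom rmorphM mps_homM coefM.
by apply: eq_bigr => i _; rewrite !coef_poly_hom.
Qed.

Lemma poly_homX A n : (0 < n)%N -> poly_hom (A ^+ n) = poly_hom A ^+ n.
Proof.
case: n => // n _; elim: n => [|n IH]; first by rewrite !expr1.
by rewrite exprS poly_homM IH -exprS.
Qed.

Lemma poly_hom_neq0 A : A != 0 -> poly_hom A != 0.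
Proof.
move=> A0; apply: contra_neq A0 => e; apply/mpolyP => m.
have := coef_poly_hom A (mdeg m); rewrite e coef0 => /esym /mpolyP /(_ m).
by rewrite mps_homE eqxx.
Qed.

Lemma size_poly_hom A : (size (poly_hom A) <= msize A)%N.
Proof. exact: size_poly. Qed.

(* Column (i, true) carries the i-th coefficient of P and column (i, false)   *)
(* that of Q in the equation P * u = Q * v, read in powers of t.              *)
Definition pade_mx (R : comNzRingType) N (u v : mps d R) (n : nat)
    (c : 'I_N.+1 * bool) : {mpoly R[d]} :=
  if (n < c.1)%N then 0 else
  if c.2 then mps_hom u (n - c.1) else - mps_hom v (n - c.1).

Lemma map_pade_mx (A B : comNzRingType) (h : {rmorphism A -> B}) N (u v : mps d A) n c :
  map_mpoly h (@pade_mx A N u v n c) = @pade_mx B N (mps_map h u) (mps_map h v) n c.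
Proof.
rewrite /pade_mx; case: ifP => _; first by rewrite rmorph0.
by case: ifP => _; rewrite ?rmorphN /= map_mps_hom.
Qed.

Lemma sum_pade_mx (L : comNzRingType) (h : {rmorphism {mpoly K[d]} -> L}) N u v
    (x : 'I_N.+1 * bool -> L) n :
  \sum_c h (@pade_mx K N u v n c) * x c =
  conv (\poly_(i < N.+1) x (inord i, true)) (h \o mps_hom u) n -
  conv (\poly_(i < N.+1) x (inord i, false)) (h \o mps_hom v) n.
Proof.
have cE b (w : mps d K) :
    conv (\poly_(i < N.+1) x (inord i, b)) (h \o mps_hom w) n =
    \sum_(i < N.+1) if (n < i)%N then 0 else h (mps_hom w (n - i)) * x (i, b).
  rewrite (convE _ _ (ltnSn n)) poly_def mulr_suml coef_sum.
  apply: eq_bigr => i _; rewrite inord_val -scalerAl coefZ coefXnM.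
  case: ltnP => _; first by rewrite mulr0.
  by rewrite coef_poly ltnS leq_subr mulrC.
rewrite !cE -sumrB.
transitivity (\sum_(i < N.+1) \sum_(b : bool) h (pade_mx u v n (i, b)) * x (i, b)).
  by rewrite pair_bigA; apply: eq_bigr => -[].
apply: eq_bigr => i _; rewrite big_bool /pade_mx /=; case: ifP => _.
  by rewrite rmorph0 !mul0r addr0 subr0.
by rewrite rmorphN mulNr.
Qed.

(** Keeps the monomials t^(deg m + s) x^m, those of excess s, and sets t = 1. The monomials of u(t
    x) have excess 0, so multiplication by it preserves the excess; this gives [dehomM]. *)
Definition dehom s (P : {poly {mpoly K[d]}}) : {mpoly K[d]} :=
  mps_trunc (size P) (MPs (fun m => (P`_(mdeg m + s))@_m)).

Lemma dehomE s (P : {poly {mpoly K[d]}}) m : (dehom s P)@_m = (P`_(mdeg m + s))@_m.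
Proof.
have [lt|le] := ltnP (mdeg m) (size P); first exact: mps_truncE.
rewrite nth_default ?mcoeff0; last by rewrite (leq_trans le) // leq_addr.
rewrite raddf_sum big1 //= => k _; rewrite mcoeffZ mcoeffX.
case: eqP => [e|_]; last by rewrite mulr0.
by move: le; rewrite -e leqNgt bmdeg.
Qed.

Lemma dehomM s (P : {poly {mpoly K[d]}}) u m :
  ((dehom s P)%:S * u) m = (conv P (mps_hom u) (mdeg m + s))@_m.
Proof.
rewrite /conv [RHS]raddf_sum mps_coefM /=.
under [RHS]eq_bigr do rewrite mcoeffM.
rewrite exchange_big /=; apply: eq_bigr => -[[k1 h1] [k2 h2]] /= /eqP e.
rewrite dehomE.
have lt1 : (mdeg k1 + s < (mdeg m + s).+1)%N by rewrite ltnS leq_add2r -ltnS.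
rewrite (bigD1 (Ordinal lt1)) //= !mps_homE subnDr {1}e mdegD addKn eqxx.
rewrite big1 ?addr0 // => i ne; rewrite !mps_homE; case: eqP => [e1|_]; last by rewrite mulr0.
case/eqP: ne; apply/val_inj => /=; have := ltn_ord i; rewrite ltnS => le_i.
by apply/eqP; rewrite -(eqn_add2r (mdeg k2)) addnAC -mdegD -e e1 subnKC.
Qed.

(** A kernel vector gives polynomials in t over the fraction field of K[x]. Once denominators are
    cleared, the part of a fixed excess on each side gives polynomials in x alone. *)
Lemma pade_kernel_ratfun N u v : u != 0 -> v != 0 ->
  has_kernel (fun n c => frac (@pade_mx K N u v n c)) ->
  exists P Q, [/\ P != 0, Q != 0 & P%:S * u = Q%:S * v].
Proof.
move=> u0 v0 [x [[[i0 b0] xi0] ker]].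
have [b b_neq0 [y yE]] := common_denominator x.
pose X c := \poly_(i < N.+1) y (inord i, c).
have XE n : conv (X true) (mps_hom u) n = conv (X false) (mps_hom v) n.
  apply/eqP; rewrite -subr_eq0 -[mps_hom u]/(idfun \o mps_hom u).
  rewrite -[mps_hom v]/(idfun \o mps_hom v) -(sum_pade_mx idfun) /=.
  rewrite -tofrac_eq0 rmorph_sum /=; apply/eqP.
  transitivity (frac b * \sum_c frac (pade_mx u v n c) * x c); last by rewrite ker mulr0.
  rewrite mulr_sumr; apply: eq_bigr => c _.
  by rewrite rmorphM /= -yE mulrCA.
have Xb0 : X b0 != 0.
  apply: contraNneq xi0 => /polyP /(_ i0); rewrite coef_poly ltn_ord coef0 inord_val => yi.
  have := yE (i0, b0); rewrite yi rmorph0 => /eqP; rewrite mulf_eq0 tofrac_eq0.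
  by rewrite (negPf b_neq0).
have key (w z : mps d K) (P Q : {poly {mpoly K[d]}}) : w != 0 -> z != 0 -> P != 0 ->
    (forall n, conv P (mps_hom w) n = conv Q (mps_hom z) n) ->
    exists P' Q', [/\ P' != 0, Q' != 0 & P'%:S * w = Q'%:S * z].
  move=> w0 z0 P0 PQ.
  have [m lm] : exists m, (lead_coef P)@_m != 0.
    apply: contrapT => nm; move: P0; rewrite -lead_coef_eq0 => /eqP[].
    apply/mpolyP => m; rewrite mcoeff0; apply/eqP/negPn/negP => nz.
    by apply: nm; exists m.
  (* The monomial t^i x^m of [P] has excess i - e, possibly negative; the factor t^e raises it to
     i. *)
  set i := (size P).-1; set e := mdeg m.
  have P'0 : dehom i ('X^e * P) != 0.
    apply: contraNneq lm => /mpolyP /(_ m).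
    by rewrite dehomE mcoeff0 coefXnM ltnNge leq_addr /= addKn -lead_coefE => ->.
  have PQ' : (dehom i ('X^e * P))%:S * w = (dehom i ('X^e * Q))%:S * z.
    apply/mpsP => k; rewrite !dehomM !convM; congr (_@_k).
    by apply: eq_conv => l; apply: PQ.
  exists (dehom i ('X^e * P)), (dehom i ('X^e * Q)); split=> //.
  apply: contraNneq P'0 => Q0; move: PQ'; rewrite Q0 rmorph0 mul0r => /eqP.
  by rewrite mulf_eq0 (negPf w0) orbF mps_of_mpoly_eq0.
case: b0 {xi0} Xb0 => Xb0; first exact: key Xb0 XE.
have [|P [Q [P0 Q0 e]]] := key v u (X false) (X true) v0 u0 Xb0; first by move=> n; rewrite XE.
by exists Q, P; rewrite e.
Qed.

(** After the substitution of t x for x, these are polynomials in t over the field [E], so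
    [poly_ratio_bound] applies. The common factor G cancels from P * u = Q * v by [conv_eq0], and
    the coefficients of P' and Q' form the kernel vector. *)
Lemma pade_kernel P Q R1 R2 r N u v :
  P != 0 -> Q != 0 -> R1 != 0 -> R2 != 0 -> (0 < r)%N ->
  P ^+ r * R1 = Q ^+ r * R2 ->
  (msize R1 <= (N * r).+1)%N -> (msize R2 <= (N * r).+1)%N ->
  P%:S * u = Q%:S * v ->
  has_kernel (fun n c => frac (@pade_mx K N u v n c)).
Proof.
move=> P0 Q0 R10 R20 r_gt0 e s1 s2 PQ.
pose F A : {poly E} := map_poly frac (poly_hom A).
have F0 A : A != 0 -> F A != 0.
  move=> A0; rewrite map_poly_eq0_id0 ?poly_hom_neq0 //.
  by rewrite tofrac_eq0 lead_coef_eq0 poly_hom_neq0.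
have sF A n : (msize A <= n)%N -> (size (F A) <= n)%N.
  by apply: leq_trans; apply: leq_trans (size_poly _ _) (size_poly_hom A).
have FE : F P ^+ r * F R1 = F Q ^+ r * F R2.
  by rewrite /F -!rmorphXn -!rmorphM /= -!poly_homX // -!poly_homM e.
have [G [P' [Q' [G0 PE QE [sP' sQ']]]]] :=
  poly_ratio_bound (F0 _ P0) (F0 _ Q0) (F0 _ R10) (F0 _ R20) r_gt0 FE (sF _ _ s1) (sF _ _ s2).
have convF A w n : conv (F A) (frac \o mps_hom w) n = frac (mps_hom (A%:S * w) n).
  rewrite mps_homM rmorph_sum; apply: eq_bigr => i _.
  by rewrite rmorphM /= coef_map /= coef_poly_hom.
have key n : conv P' (frac \o mps_hom u) n - conv Q' (frac \o mps_hom v) n = 0.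
  move: n; apply: (conv_eq0 G0) => n; rewrite convB -!convM ![G * _]mulrC -PE -QE.
  by rewrite !convF PQ subrr.
pose x (c : 'I_N.+1 * bool) := if c.2 then P'`_c.1 else Q'`_c.1.
exists x; split.
  have P'0 : P' != 0 by apply: contraNneq (F0 _ P0) => P'0; rewrite PE P'0 mul0r.
  have lt : ((size P').-1 < N.+1)%N.
    by apply: leq_trans sP'; rewrite ltn_predL size_poly_gt0.
  by exists (Ordinal lt, true); rewrite /x /= -lead_coefE lead_coef_eq0.
move=> n; rewrite (sum_pade_mx frac) -[RHS](key n).
have polyE (A : {poly E}) : (size A <= N.+1)%N ->
    \poly_(i < N.+1) A`_(@inord N i) = A.
  move=> sA; apply/polyP => i; rewrite coef_poly; case: ltnP => h; first by rewrite inordK.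
  by rewrite nth_default // (leq_trans sA).
by rewrite /x /= !polyE.
Qed.

End Field.
End Homogeneous.

(** * Localization and residue map *)

Section PrimeQuotient.
Local Open Scope quotient_scope.
Variables (R : idomainType) (p : prime_idealr R).

(** An alias that carries a structure of integral domain, so that its fraction field can be
    formed. *)
Definition prime_quot : Type := {ideal_quot p}.
HB.instance Definition _ := GRing.ComNzRing.copy prime_quot {ideal_quot p}.

Definition prime_quot_unit : pred prime_quot := fun x => `[< exists y, y * x = 1 >].

Definition prime_quot_inv (x : prime_quot) : prime_quot :=
  if pselect (exists y, y * x = 1) is left ex then sval (cid ex) else x.

Fact prime_quot_mulVr :
  {in prime_quot_unit, left_inverse 1 prime_quot_inv *%R}.
Proof.
move=> x /asboolP ux; rewrite /prime_quot_inv.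
by case: pselect => // ex; exact: (svalP (cid ex)).
Qed.

Fact prime_quot_unitP x y : y * x = 1 -> prime_quot_unit x.
Proof. by move=> yx; apply/asboolP; exists y. Qed.

Fact prime_quot_inv_out : {in [predC prime_quot_unit], prime_quot_inv =1 id}.
Proof.
move=> x; rewrite inE /prime_quot_inv; case: pselect => // ex /negP[].
exact/asboolP.
Qed.

HB.instance Definition _ := GRing.ComNzRing_hasMulInverse.Build prime_quot
  prime_quot_mulVr prime_quot_unitP prime_quot_inv_out.

Fact prime_quot_mulf_eq0 (x y : prime_quot) : x * y = 0 -> (x == 0) || (y == 0).
Proof. exact: Quotient.rquot_IdomainAxiom. Qed.

HB.instance Definition _ :=
  GRing.ComUnitRing_isIntegral.Build prime_quot prime_quot_mulf_eq0.

Definition to_quot : R -> prime_quot := \pi_{ideal_quot p}.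
HB.instance Definition _ := GRing.RMorphism.copy to_quot (\pi_{ideal_quot p}).

Lemma to_quot_eq0 a : (to_quot a == 0) = (a \in p).
Proof. by rewrite -(rmorph0 to_quot) -[a in RHS]subr0 Quotient.idealrBE. Qed.
End PrimeQuotient.

Section Localization.
Variables (R : idomainType) (p : prime_idealr R).
Local Notation K := {fraction R}.
Local Notation frac := (@FracField.tofrac R).
Local Notation Q := (prime_quot p).
Local Notation piQ := (@to_quot R p).
Local Notation fracQ := (@FracField.tofrac Q).

Definition loc_pred : {pred K} := fun z => `[< localization p z >].

Lemma notin_prime_neq0 b : b \notin p -> b != 0.
Proof. by apply: contraNneq => ->; exact: idealr0. Qed.

Fact loc_pred_subring : subring_closed loc_pred.
Proof.
have dF b : b \notin p -> frac b != 0 by move=> /notin_prime_neq0; rewrite tofrac_eq0.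
split.
- apply/asboolP; exists 1, 1; split; first by rewrite idealr1.
  by rewrite rmorph1 divr1.
- move=> x y /asboolP[a [b [bp ->]]] /asboolP[a' [b' [bp' ->]]].
  apply/asboolP; exists (a * b' - a' * b), (b * b'); split.
    by rewrite prime_idealrM negb_or bp.
  by rewrite -mulNr addf_div ?dF // mulNr rmorphB !rmorphM.
- move=> x y /asboolP[a [b [bp ->]]] /asboolP[a' [b' [bp' ->]]].
  apply/asboolP; exists (a * a'), (b * b'); split.
    by rewrite prime_idealrM negb_or bp.
  by rewrite mulf_div !rmorphM.
Qed.

HB.instance Definition _ :=
  GRing.isSubringClosed.Build K loc_pred loc_pred_subring.

Record locring := Locring { locval :> K; _ : locval \in loc_pred }.
HB.instance Definition _ := [isSub for locval].
HB.instance Definition _ := [Choice of locring by <:].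
HB.instance Definition _ := [SubChoice_isSubComNzRing of locring by <:].

Fact locval_zmod_morphism : zmod_morphism locval.
Proof. exact: (raddfB (\val : locring -> K)). Qed.

Fact locval_monoid_morphism : monoid_morphism locval.
Proof. exact: (rmorphism_monoidP (\val : locring -> K)). Qed.

HB.instance Definition _ :=
  GRing.isZmodMorphism.Build locring K locval locval_zmod_morphism.
HB.instance Definition _ :=
  GRing.isMonoidMorphism.Build locring K locval locval_monoid_morphism.

Lemma locvalP (z : locring) : localization p (locval z).
Proof. by case: z => z /= /asboolP. Qed.

Lemma locval_surj (z : K) : localization p z -> exists x : locring, locval x = z.
Proof. by move=> /asboolP lz; exists (Locring lz). Qed.

Lemma locval_frac (a : R) : exists x : locring, locval x = frac a.
Proof.
apply: locval_surj; exists a, 1; split; first by rewrite idealr1.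
by rewrite rmorph1 divr1.
Qed.

Definition to_loc (a : R) : locring := sval (cid (locval_frac a)).

Lemma locval_to_loc a : locval (to_loc a) = frac a.
Proof. exact: (svalP (cid (locval_frac a))). Qed.

Fact to_loc_zmod_morphism : zmod_morphism to_loc.
Proof.
move=> a b; apply: val_inj; rewrite -[LHS]/(locval _) locval_to_loc.
by rewrite [RHS](raddfB locval) /= !locval_to_loc (rmorphB frac).
Qed.

Fact to_loc_monoid_morphism : monoid_morphism to_loc.
Proof.
split; first by apply: val_inj; rewrite -[LHS]/(locval _) locval_to_loc rmorph1.
move=> a b; apply: val_inj; rewrite -[LHS]/(locval _) locval_to_loc.
by rewrite [RHS](rmorphM locval) /= !locval_to_loc (rmorphM frac).
Qed.

HB.instance Definition _ :=
  GRing.isZmodMorphism.Build R locring to_loc to_loc_zmod_morphism.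
HB.instance Definition _ :=
  GRing.isMonoidMorphism.Build R locring to_loc to_loc_monoid_morphism.

(** The representation a / b is picked by choice; [residueE] shows independence of it. Values are
    taken in the fraction field of R / p, which provides a field at once. *)
Definition residue (z : locring) : {fraction Q} :=
  let ab := cid (locvalP z) in
  fracQ (piQ (sval ab)) / fracQ (piQ (sval (cid (svalP ab)))).

Lemma residueE (z : locring) a b : b \notin p -> locval z = frac a / frac b ->
  residue z = fracQ (piQ a) / fracQ (piQ b).
Proof.
rewrite /residue; set ab := cid _; set b1 := svalP ab => bp zE.
case: (cid b1) => b' /= [b'p zE']; set a' := sval ab in zE' *.
have nz c : c \notin p -> frac c != 0 /\ fracQ (piQ c) != 0.
  by move=> cp; rewrite !tofrac_eq0 to_quot_eq0 notin_prime_neq0.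
have [d1 d2] := nz _ bp; have [d1' d2'] := nz _ b'p.
apply/eqP; rewrite (eqr_div _ _ d2' d2).
rewrite -!(rmorphM fracQ) -!(rmorphM piQ).
suff -> : a' * b = a * b' by exact: eqxx.
apply/eqP; rewrite -tofrac_eq !(rmorphM frac) /= -(eqr_div _ _ d1' d1).
by rewrite -zE -zE' eqxx.
Qed.

Fact residue_zmod_morphism : zmod_morphism residue.
Proof.
move=> x y; have [a [b [bp xE]]] := locvalP x; have [a' [b' [bp' yE]]] := locvalP y.
have nz c : c \notin p -> frac c != 0 /\ fracQ (piQ c) != 0.
  by move=> cp; rewrite !tofrac_eq0 to_quot_eq0 notin_prime_neq0.
have [d1 d2] := nz _ bp; have [d1' d2'] := nz _ bp'.
rewrite (residueE bp xE) (residueE bp' yE).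
rewrite (@residueE _ (a * b' - a' * b) (b * b')).
- rewrite -[in RHS]mulNr (addf_div _ _ d2 d2') mulNr.
  by rewrite !(rmorphB piQ, rmorphM piQ) !(rmorphB fracQ, rmorphM fracQ).
- by rewrite prime_idealrM negb_or bp.
- rewrite [LHS](raddfB locval) /= xE yE -mulNr (addf_div _ _ d1 d1') mulNr.
  by rewrite !(rmorphB frac, rmorphM frac).
Qed.

Fact residue_monoid_morphism : monoid_morphism residue.
Proof.
split.
  rewrite (@residueE _ 1 1) ?idealr1 //; first by rewrite !rmorph1 divr1.
  by rewrite [LHS]rmorph1 rmorph1 divr1.
move=> x y; have [a [b [bp xE]]] := locvalP x; have [a' [b' [bp' yE]]] := locvalP y.
rewrite (residueE bp xE) (residueE bp' yE).
rewrite (@residueE _ (a * a') (b * b')).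
- by rewrite mulf_div !(rmorphM piQ) !(rmorphM fracQ).
- by rewrite prime_idealrM negb_or bp.
- by rewrite [LHS](rmorphM locval) /= xE yE mulf_div !(rmorphM frac).
Qed.

HB.instance Definition _ := GRing.isZmodMorphism.Build locring {fraction Q}
  residue residue_zmod_morphism.
HB.instance Definition _ := GRing.isMonoidMorphism.Build locring {fraction Q}
  residue residue_monoid_morphism.

Lemma residue_to_loc a : residue (to_loc a) = fracQ (piQ a).
Proof.
rewrite (@residueE _ a 1) ?idealr1 //; first by rewrite !rmorph1 divr1.
by rewrite locval_to_loc rmorph1 divr1.
Qed.

Lemma residue_max (z : locring) : localization_max p (locval z) -> residue z = 0.
Proof.
move=> [a [b [ap bp zE]]]; rewrite (residueE bp zE).
by move: ap; rewrite -to_quot_eq0 => /eqP ->; rewrite rmorph0 mul0r.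
Qed.

(** Here [b] may lie in [p]: in [pade_obstruction] the fraction is chosen before [p]. Against a
    representation a' / b' with b' outside [p], the product a * b' = a' * b lies in [p]. *)
Lemma residue_eq0 (z : locring) a b :
  b != 0 -> locval z = frac a / frac b -> residue z = 0 -> a \in p.
Proof.
move=> b0 zE; have [a' [b' [b'p zE']]] := locvalP z.
rewrite (residueE b'p zE') => /eqP; rewrite mulf_eq0 invr_eq0 !tofrac_eq0 !to_quot_eq0.
rewrite (negPf b'p) orbF => a'p; move/eqP: zE; rewrite zE' eqr_div ?tofrac_eq0 //.
  rewrite -!rmorphM /= tofrac_eq => /eqP e.
  have : a * b' \in p by rewrite -e prime_idealrM a'p.
  by rewrite prime_idealrM (negPf b'p) orbF.
exact: notin_prime_neq0.
Qed.

End Localization.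

(** * Iterating the functional equation *)

(** Every point is periodic, and the product of the periods is a common period. It is applied to a
    power of Frobenius on R / p. *)
Lemma finite_injection_iter (T : Type) (g : T -> T) :
  finite_set [set: T] -> injective g ->
  exists2 e, (0 < e)%N & forall x, iter e g x = x.
Proof.
move=> finT inj_g.
have injX i : injective (iter i g).
  by elim: i => [|i IH] x y //= /inj_g /IH.
have [s sT] : exists s : seq {classic T}, forall x : T, (x : {classic T}) \in s.
  have /finite_seqP[s sE] : finite_set [set: {classic T}] by [].
  by exists s => x; have : [set` s] x by rewrite -sE.
have orb (x : {classic T}) : exists2 e, (0 < e)%N & iter e g x = x.
  pose t : seq {classic T} := [seq iter i g x | i <- iota 0 (size s).+1].
  have nut : ~~ uniq t.
    apply: contraT; rewrite negbK => ut.
    have := uniq_leq_size ut (s2 := s) (fun y _ => sT y).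
    by rewrite size_map size_iota ltnn.
  have [i [j [lt_ij e]]] : exists i j, (i < j)%N /\ iter i g x = iter j g x.
    apply: contrapT => nij; case/negP: nut; rewrite map_inj_in_uniq ?iota_uniq //.
    move=> i j _ _ eij; have [lt|lt|//] := ltngtP i j.
      by case: nij; exists i, j.
    by case: nij; exists j, i.
  exists (j - i)%N; first by rewrite subn_gt0.
  by apply: (injX i); rewrite -iterD subnKC ?(ltnW lt_ij).
have /choice[E EP] x : exists e, (0 < e)%N /\ iter e g x = x.
  by have [e] := orb x; exists e.
exists (\prod_(x <- s) E x)%N.
  by rewrite prodn_gt0 // => x; case: (EP x).
move=> x; have /dvdnP[k ->] : (E x %| \prod_(y <- s) E y)%N.
  by rewrite (big_rem (x : {classic T})) ?sT //= dvdn_mulr.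
elim: k => // k IH; rewrite mulSn addnC iterD.
by case: (EP x) => _ ->.
Qed.

Section FrobPow.
Variables (K : fieldType) (p : nat) (pK : p \in [pchar K]) (b : nat).

(** The proof about the characteristic is an argument so that a ring morphism structure can be
    attached to the function. *)
Definition frob_pow of p \in [pchar K] := fun y : K => y ^+ (p ^ b).
Local Notation tau := (frob_pow pK).

Let natq : [pchar K].-nat (p ^ b)%N.
Proof. by rewrite (eq_pnat _ (pcharf_eq pK)) pnatX pnat_id // (pcharf_prime pK). Qed.

Fact frob_pow_zmod_morphism : zmod_morphism tau.
Proof. by move=> x y; rewrite /frob_pow exprDn_pchar // exprNn_pchar. Qed.

Fact frob_pow_monoid_morphism : monoid_morphism tau.
Proof. by split=> [|x y]; rewrite /frob_pow ?expr1n ?exprMn. Qed.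

HB.instance Definition _ := GRing.isZmodMorphism.Build K K tau frob_pow_zmod_morphism.
HB.instance Definition _ := GRing.isMonoidMorphism.Build K K tau frob_pow_monoid_morphism.
End FrobPow.

Section Degree.
Variables (d : nat) (K : fieldType).
Implicit Types P Q : {mpoly K[d]}.

Lemma msizeM_bound P Q a b : (msize P <= a.+1)%N -> (msize Q <= b.+1)%N ->
  (msize (P * Q) <= (a + b).+1)%N.
Proof.
have [->|P0] := eqVneq P 0; first by rewrite mul0r msize0.
have [->|Q0] := eqVneq Q 0; first by rewrite mulr0 msize0.
move=> sP sQ; rewrite msizeM //.
by have := leq_add sP sQ; rewrite addnS addSn; case: (_ + _)%N.
Qed.

Lemma msizeX_bound P a n : (msize P <= a.+1)%N -> (msize (P ^+ n) <= (a * n).+1)%N.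
Proof.
move=> sP; elim: n => [|n IH]; first by rewrite expr0 msize1.
by rewrite exprS mulnS msizeM_bound.
Qed.

Lemma msize_prod_bound n (P : 'I_n -> {mpoly K[d]}) (m : 'X_{1..n}) a :
  (forall i, (msize (P i) <= a.+1)%N) ->
  (msize (\prod_(i < n) P i ^+ m i) <= (a * mdeg m).+1)%N.
Proof.
move=> sP; rewrite mdegE big_distrr /=.
elim/big_rec2: _ => [|i A y _ sA]; first by rewrite msize1.
by rewrite msizeM_bound // msizeX_bound.
Qed.
End Degree.

(** Applying phi to V' * g = U' * phi^n(g) and combining with V * g = U * phi(g) gives the next
    step. Degrees grow to h (1 + q + ... + q^(n-1)), a sum written without division. *)
Lemma iterate_twisted_equation (d : nat) (K : fieldType) (q : nat)
    (phi : mps d K -> mps d K) (psi : {mpoly K[d]} -> {mpoly K[d]})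
    (U V : {mpoly K[d]}) (g : mps d K) h n :
  (0 < q)%N -> {morph phi : x y / x * y} ->
  (forall P, phi (mps_of_mpoly P) = mps_of_mpoly (psi P)) ->
  (forall P, P != 0 -> psi P != 0) ->
  (forall P b, (msize P <= b.+1)%N -> (msize (psi P) <= (b * q).+1)%N) ->
  U != 0 -> V != 0 -> (msize U <= h.+1)%N -> (msize V <= h.+1)%N ->
  mps_of_mpoly V * g = mps_of_mpoly U * phi g ->
  exists U' V', [/\ U' != 0, V' != 0,
    mps_of_mpoly V' * g = mps_of_mpoly U' * iter n phi g &
    exists2 h', (h' * q.-1 = h * (q ^ n).-1)%N &
      (msize U' <= h'.+1)%N /\ (msize V' <= h'.+1)%N].
Proof.
move=> q_gt0 phiM psiE psi0 spsi U0 V0 sU sV Vg.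
elim: n => [|n [U' [V' [U'0 V'0 Vg' [h' hE [sU' sV']]]]]].
  exists 1, 1; split; rewrite ?oner_neq0 //.
  by exists 0%N; rewrite ?msize1 // expn0 muln0.
exists (U * psi U'), (V * psi V'); split.
- by rewrite mulf_neq0 // psi0.
- by rewrite mulf_neq0 // psi0.
- rewrite !rmorphM /= -!psiE mulrAC Vg -!mulrA; congr (_ * _).
  by rewrite mulrC -!phiM Vg'.
- exists (h + h' * q)%N; last first.
    by split; apply: msizeM_bound => //; apply: spsi.
  rewrite mulnDl mulnAC hE mulnAC -mulnA -mulnDr; congr (_ * _)%N.
  rewrite expnS; move: (q ^ n)%N (expn_gt0 q n); rewrite q_gt0 /= => y y_gt0.
  case: {-1}q q_gt0 => // x _; case: y y_gt0 => // y _.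
  by rewrite /= mulSn mulnS /= mulnC; lia.
Qed.

Section Iteration.
Variables (d : nat) (K : fieldType) (p a e : nat).
Hypotheses (pK : p \in [pchar K]) (e_gt0 : (0 < e)%N).
Hypothesis fixK : forall y : K, y ^+ (p ^ (a * e)) = y.
Local Notation q := (p ^ a)%N.
Local Notation "A %:S" := (mps_of_mpoly A) (at level 2, format "A %:S").
Local Notation tau := (frob_pow (a * e.-1) pK).

(* Writing the substitution of x ^ q for x as a q-th power shows that it is   *)
(* multiplicative.                                                            *)
Let phi (f : mps d K) := mps_map tau f ^+ q.

Let phiE f : phi f = mps_subst_pow q f.
Proof.
rewrite /phi mps_frobenius //; congr mps_subst_pow; apply/mpsP => m /=.
by rewrite /frob_pow -exprM -expnD -mulnSr prednK.
Qed.

Let tau_iter y : iter e tau y = y.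
Proof.
have -> n : iter n tau y = y ^+ (p ^ (a * e.-1 * n)).
  by elim: n => [|n IH]; rewrite ?muln0 ?expr1 //= IH /frob_pow -exprM -expnD mulnS addnC.
rewrite -mulnA [(_ * e)%N]mulnC mulnA.
elim: e.-1 => [|n IH]; first by rewrite muln0 expr1.
by rewrite mulnS expnD exprM fixK.
Qed.

(** On K, [tau] inverts the q-th power, and its e-th iterate is the identity. Hence the e-th iterate
    of [phi] is the plain power of exponent q^e, and the substitution has disappeared. *)
Lemma iterate_functional_equation (U V : {mpoly K[d]}) (g : mps d K) h :
  U != 0 -> V != 0 -> (msize U <= h.+1)%N -> (msize V <= h.+1)%N ->
  V%:S * g = U%:S * mps_subst_pow q g ->
  exists U' V', [/\ U' != 0, V' != 0, V'%:S * g = U'%:S * g ^+ (p ^ (a * e)) &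
    exists2 h', (h' * q.-1 = h * (p ^ (a * e)).-1)%N &
      (msize U' <= h'.+1)%N /\ (msize V' <= h'.+1)%N].
Proof.
move=> U0 V0 sU sV; rewrite -phiE => Vg.
have q_gt0 : (0 < q)%N by rewrite expn_gt0 prime_gt0 // (pcharf_prime pK).
have phiM x y : phi (x * y) = phi x * phi y by rewrite /phi rmorphM exprMn.
pose psi (P : {mpoly K[d]}) := map_mpoly tau P ^+ q.
have psiE P : phi P%:S = (psi P)%:S.
  rewrite /phi /psi rmorphXn; congr (_ ^+ _); apply/mpsP => m /=.
  by rewrite mcoeff_map_mpoly.
have psi0 P : P != 0 -> psi P != 0.
  move=> P0; rewrite expf_neq0 //; apply: contraNneq P0 => /mpolyP e0.
  apply/eqP/mpolyP => m; apply: (fmorph_inj tau).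
  by have := e0 m; rewrite mcoeff_map_mpoly !mcoeff0 rmorph0.
have spsi P b : (msize P <= b.+1)%N -> (msize (psi P) <= (b * q).+1)%N.
  move=> sP; apply: msizeX_bound; apply: leq_trans sP.
  rewrite leqNgt; apply/negP => lt.
  have : map_mpoly tau P != 0.
    by rewrite -msize_poly_eq0 -lt0n; apply: leq_ltn_trans lt.
  move=> P0; move: lt; rewrite -(mlead_deg P0) ltnS => /msize_mdeg_ge.
  rewrite -mcoeff_eq0 => /eqP z.
  by move: P0; rewrite -mleadc_eq0 mcoeff_map_mpoly z raddf0 eqxx.
have [U' [V' [U'0 V'0 Vg' [h' hE s']]]] :=
  iterate_twisted_equation e q_gt0 phiM psiE psi0 spsi U0 V0 sU sV Vg.
exists U', V'; split=> //; last by exists h'; rewrite // expnM.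
rewrite Vg'; congr (_ * _).
have -> n : iter n phi g = mps_map (iter n tau) g ^+ (q ^ n).
  elim: n => [|n IH]; first by rewrite expr1; apply/mpsP.
  rewrite iterS IH /phi rmorphXn -exprM -expnSr; congr (_ ^+ _).
by rewrite -expnM; congr (_ ^+ _); apply/mpsP => m /=; rewrite tau_iter.
Qed.
End Iteration.

(** * Rational functions modulo a prime *)

Section Reduction.
Variables (d : nat) (A : comNzRingType) (K k : fieldType).
Variables (iota : {rmorphism A -> K}) (pi : {rmorphism A -> k}).
Local Notation "A %:S" := (mps_of_mpoly A) (at level 2, format "A %:S").

(** The coefficients of U and V need not come from [A], and could all reduce to 0. Instead V * a = U
    is read as a linear system over [A] in the coefficients of U and V, whose solvability passes to
    [k] by [has_kernel_map]. *)
Lemma rational_reduction (a : mps d A) (B : nat) :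
  injective iota ->
  (exists U V : {mpoly K[d]}, [/\ V != 0, (msize U <= B)%N, (msize V <= B)%N &
    V%:S * mps_map iota a = U%:S]) ->
  exists U V : {mpoly k[d]}, [/\ V != 0, (msize U <= B)%N, (msize V <= B)%N &
    V%:S * mps_map pi a = U%:S].
Proof.
move=> inj_iota [U [V [V0 sU sV VU]]].
pose mono (R : comNzRingType) (j : 'X_{1..d}) : mps d R := MPs (fun m => (j == m)%:R).
have monoE (F : fieldType) j : mono F j = ('X_[j])%:S.
  by apply/mpsP => m /=; rewrite mcoeffX.
pose J : finType := ('X_{1..d < B} * bool)%type.
pose M (t : 'X_{1..d}) (j : J) : A :=
  if j.2 then (mono A j.1 * a) t else - mono A j.1 t.
pose X (F : fieldType) (x : J -> F) b : {mpoly F[d]} :=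
  \sum_(i : 'X_{1..d < B}) x (i, b) *: 'X_[i].
have sumM (F : fieldType) (h : {rmorphism A -> F}) (x : J -> F) t :
    \sum_j h (M t j) * x j = ((X F x true)%:S * mps_map h a) t - (X F x false)%:S t.
  transitivity (\sum_(i : 'X_{1..d < B}) \sum_(b : bool) h (M t (i, b)) * x (i, b)).
    by rewrite pair_bigA; apply: eq_bigr => -[].
  have XE b : (X F x b)%:S = \sum_(i : 'X_{1..d < B}) (x (i, b))%:MP%:S * mono F i.
    rewrite rmorph_sum; apply: eq_bigr => i _.
    by rewrite monoE -rmorphM /= mul_mpolyC.
  rewrite !XE mulr_suml !mps_coef_sum -sumrB; apply: eq_bigr => i _.
  rewrite big_bool -mulrA !mps_coefCM -mulrN.
  congr (_ + _); rewrite mulrC; congr (_ * _); last by rewrite rmorphN rmorph_nat.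
  rewrite -[LHS]/(mps_map h (mono A i * a) t) rmorphM; congr (mps_coef (_ * _) _).
  by apply/mpsP => m /=; rewrite rmorph_nat.
have sX (F : fieldType) (x : J -> F) b : (msize (X F x b) <= B)%N.
  apply: leq_trans (msize_sum _ _ _) _; apply/bigmax_leqP => i _.
  by apply: leq_trans (msizeZ_le _ _) _; rewrite msizeX bmdeg.
have kerK : has_kernel (fun t j => iota (M t j)).
  pose x (j : J) := if j.2 then V@_j.1 else U@_j.1.
  have XV : X K x true = V by rewrite /X -mpolywE.
  have XU : X K x false = U by rewrite /X -mpolywE.
  exists x; split; last by move=> t; rewrite sumM XV XU VU subrr.
  apply: contrapT => nx; case/eqP: V0; rewrite -XV.
  apply: big1 => i _; have [->|nz] := eqVneq (x (i, true)) 0; first by rewrite scale0r.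
  by case: nx; exists (i, true).
have [x [[[i b] xib] ker]] := has_kernel_map pi inj_iota kerK.
have VUk : (X k x true)%:S * mps_map pi a = (X k x false)%:S.
  by apply/mpsP => t; apply/eqP; rewrite -subr_eq0 -sumM ker.
exists (X k x false), (X k x true); split=> //.
apply: contraNneq xib => V0'.
have Xb b' : X k x b' = 0.
  case: b' => //; apply/eqP; rewrite -mps_of_mpoly_eq0 -VUk V0' rmorph0 mul0r.
  exact: eqxx.
have := congr1 (mcoeff i) (Xb b); rewrite mcoeff0 raddf_sum /= (bigD1 i) //=.
rewrite mcoeffZ mcoeffX eqxx mulr1 big1 ?addr0 => [->//|l ne].
rewrite mcoeffZ mcoeffX; case: eqP => [e|_]; last by rewrite mulr0.
by case/eqP: ne; apply/val_inj.
Qed.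
End Reduction.

(** With a^r = v1 / w1 and b^r = v2 / w2, the r-th power of x * a = y * b is x^r * v1 * w2 = y^r *
    v2 * w1. The factor x * a * y replaces divisions. *)
Lemma ratio_power_identity (T : comNzRingType) (x y a b v1 v2 w1 w2 : T) r :
  x * a = y * b -> v1 * a = w1 * a ^+ r.+1 -> v2 * b = w2 * b ^+ r.+1 ->
  x ^+ r * (v1 * w2) * (x * a * y) = y ^+ r * (v2 * w1) * (x * a * y).
Proof.
move=> xy va vb; rewrite {2}xy.
rewrite [LHS](AC (1*2*3) ((4*1)*(2*5)*(3*6))) [RHS](AC (1*2*3) ((4*1)*(2*5)*(3*6))) /=.
rewrite -!exprS va vb [LHS](AC (1*2*2) ((1*3)*2*(4*5))) /= -exprMn xy.
by rewrite [RHS](AC (1*2*2) ((1*3)*4*(2*5))) /= -exprMn.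
Qed.

(** * Ratios of bounded height in positive characteristic *)

Section PositiveCharacteristic.
Variables (d n : nat) (K : fieldType) (p j : nat).
Hypotheses (pK : p \in [pchar K]) (j_gt0 : (0 < j)%N).
Hypothesis fixK : forall y : K, y ^+ (p ^ j) = y.
Local Notation q := (p ^ j)%N.
Local Notation "A %:S" := (mps_of_mpoly A) (at level 2, format "A %:S").
Local Notation "g ^^ m" := (\prod_(i < n) g i ^+ m i) (at level 30).

(* A relation among the g ^^ m yields P * g ^^ m = Q * g ^^ m'. The ratio     *)
(* Q / P is rational and its (q - 1)-st power has height O(q), so that Q / P  *)
(* has bounded height.                                                        *)
Lemma pade_kernel_pchar (g : 'I_n -> mps d K) (U V : 'I_n -> {mpoly K[d]})
    (I : finType) (mon : I -> 'X_{1..n}) (c : I -> {mpoly K[d]}) B D :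
  injective mon -> (forall i, g i 0%MM = 1) ->
  (forall i, U i != 0) -> (forall i, V i != 0) ->
  (forall i, (V i)%:S * g i = (U i)%:S * g i ^+ q) ->
  (forall i, (msize (U i) <= (B * q.-1).+1)%N) ->
  (forall i, (msize (V i) <= (B * q.-1).+1)%N) ->
  (forall i, (mdeg (mon i) <= D)%N) ->
  (exists i, c i != 0) -> \sum_i (c i)%:S * g ^^ (mon i) = 0 ->
  exists i1 i2, i1 != i2 /\
    has_kernel (fun t col => FracField.tofrac
      (@pade_mx d K (B * D + B * D) (g ^^ (mon i1)) (g ^^ (mon i2)) t col)).
Proof.
move=> inj_mon g0 U0 V0 Vg sU sV degD [i0 ci0] rel.
have q_gt1 : (1 < q)%N.
  by rewrite -(expn0 p) ltn_exp2l // prime_gt1 // (pcharf_prime pK).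
have r_gt0 : (0 < q.-1)%N by rewrite -ltnS prednK // ltnW.
pose u i := g ^^ (mon i).
have u0 i : u i != 0.
  apply/eqP => /mpsP /(_ 0%MM); rewrite mps_coef0_prod big1 => [/eqP|l _].
    by rewrite oner_eq0.
  by rewrite mps_coef0X g0 expr1n.
pose UU i := U ^^ (mon i); pose VV i := V ^^ (mon i).
have nzprod (W : 'I_n -> {mpoly K[d]}) m : (forall i, W i != 0) -> W ^^ m != 0.
  by move=> W0; apply/prodf_neq0 => i _; rewrite expf_neq0.
have VVu i : (VV i)%:S * u i = (UU i)%:S * u i ^+ q.
  rewrite !rmorph_prod /u -prodrXl -!big_split /=; apply: eq_bigr => l _.
  by rewrite !rmorphXn /= -exprMn Vg exprMn -!exprM mulnC.
have sW (W : 'I_n -> {mpoly K[d]}) i : (forall l, (msize (W l) <= (B * q.-1).+1)%N) ->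
    (msize (W ^^ (mon i)) <= (B * D * q.-1).+1)%N.
  move=> sW; apply: leq_trans (msize_prod_bound _ sW) _.
  by rewrite ltnS mulnAC leq_mul2r leq_mul2l degD !orbT.
pose s := [seq i <- enum I | c i != 0].
have [|||||||i1 [i2 [P [Q [_ _ ne [P0 Q0] PQ]]]]] :=
  @kummer d K p j pK j_gt0 fixK I s c UU VV u; last first.
- exists i1, i2; split=> //.
  (* The (q - 1)-st power of Q / P is the quotient of these two products, each of degree at most (B
     * D + B * D) * (q - 1). *)
  apply: (@pade_kernel d K P Q (VV i1 * UU i2) (VV i2 * UU i1) q.-1) => //.
  + by rewrite mulf_neq0 // nzprod.
  + by rewrite mulf_neq0 // nzprod.
  + apply: mps_of_mpoly_inj.
    have nz : P%:S * u i1 * Q%:S != 0 by rewrite !mulf_neq0 ?mps_of_mpoly_eq0.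
    apply: (mulIf nz).
    rewrite !(rmorphM (@mps_of_mpoly d K)) !(rmorphXn (@mps_of_mpoly d K)).
    by apply: (ratio_power_identity PQ); rewrite prednK ?VVu // ltnW.
  + by rewrite mulnDl msizeM_bound // sW.
  + by rewrite mulnDl msizeM_bound // sW.
- rewrite big_filter -[RHS]rel big_enum_cond [RHS](bigID (fun i => c i != 0)) /=.
  by rewrite [X in _ + X]big1 ?addr0 // => i; rewrite negbK => /eqP ->; rewrite rmorph0 mul0r.
- exact: VVu.
- exact: u0.
- by move=> i; apply: nzprod.
- by move=> i; rewrite mem_filter => /andP[].
- rewrite -has_filter; apply/hasP; exists i0 => //; exact: mem_enum.
- by rewrite filter_uniq // enum_uniq.
Qed.
End PositiveCharacteristic.

(** * Series satisfying Lucas congruences *)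

Section LucasReduction.
Variables (d : nat) (R : idomainType).
Local Notation K := {fraction R}.
Local Notation "A %:S" := (mps_of_mpoly A) (at level 2, format "A %:S").

(** Convertible to [mps_subst_pow] over a field, but also available over the localization. *)
Definition mps_dilate (V : zmodType) N (f : mps d V) : mps d V :=
  MPs (fun m => if [forall i : 'I_d, (N %| m i)%N]
                then f [multinom (m i %/ N)%N | i < d] else 0).

Lemma mps_map_dilate (A B : comNzRingType) (h : {rmorphism A -> B}) N (f : mps d A) :
  mps_map h (mps_dilate N f) = mps_dilate N (mps_map h f).
Proof. by apply/mpsP => m /=; case: ifP => // _; exact: rmorph0. Qed.

Variable p : prime_idealr R.
Local Notation Q := (prime_quot p).
Local Notation k := {fraction (prime_quot p)}.
Local Notation loc := (@locval R p).
Local Notation res := (@residue R p).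

Lemma locval_inj : injective loc.
Proof. exact: val_inj. Qed.

Lemma lift_locring (f : mps d K) : mps_over (localization p) f ->
  exists fA, mps_map loc fA = f.
Proof.
move=> fp; have [F FE] := choice (fun m => locval_surj (fp m)).
by exists (MPs F); apply/mpsP => m /=; apply: FE.
Qed.

Lemma pchar_fraction_quot r : r \in [pchar {ideal_quot p}] -> r \in [pchar k].
Proof.
by move=> rp; apply: (rmorph_pchar (@FracField.tofrac Q)).
Qed.

Lemma finite_index_frobenius r b : finite_index p -> r \in [pchar k] -> (0 < b)%N ->
  exists2 e, (0 < e)%N & forall y : k, y ^+ (r ^ (b * e)) = y.
Proof.
move=> finp rk b_gt0.
have [||e e_gt0 eE] := @finite_injection_iter Q (fun x => x ^+ (r ^ b)).
- exact: finp.
- move=> x y /(congr1 (@FracField.tofrac Q)); rewrite !rmorphXn /= => e.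
  by have /eqP := fmorph_inj (frob_pow b rk) e; rewrite tofrac_eq => /eqP.
exists e => // y.
have fixQ (x : Q) : x ^+ (r ^ (b * e)) = x.
  rewrite -[RHS]eE; elim: e {e_gt0 eE} => [|e IH]; first by rewrite muln0 expr1.
  by rewrite iterS -IH -exprM -expnD mulnSr.
have [x [z [_ ->]]] := fractionP y.
by rewrite expr_div_n -!rmorphXn /= !fixQ.
Qed.

Lemma residue_functional_equation N (fA aA : mps d (locring p)) :
  mps_over (localization_max p)
    (mps_map loc fA - mps_map loc aA * mps_subst_pow N (mps_map loc fA)) ->
  mps_map res fA = mps_map res aA * mps_subst_pow N (mps_map res fA).
Proof.
rewrite -[mps_subst_pow _ _]/(mps_dilate N (mps_map loc fA)) -mps_map_dilate.
rewrite -(rmorphM (mps_map loc)) -(rmorphB (mps_map loc)) => fmax.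
rewrite -[mps_subst_pow _ _]/(mps_dilate N (mps_map res fA)) -mps_map_dilate.
apply/eqP; rewrite -subr_eq0 -(rmorphM (mps_map res)) -(rmorphB (mps_map res)).
apply/eqP/mpsP => m; exact: residue_max (fmax m).
Qed.

Lemma has_height_mpoly (a : mps d K) h : has_height (FracField.tofrac a) h ->
  exists U V : {mpoly K[d]}, [/\ V != 0, (msize U <= h.+1)%N, (msize V <= h.+1)%N &
    V%:S * a = U%:S].
Proof.
move=> [U [V [V0 _ aE ->]]]; exists U, V; split=> //.
- by apply: leq_trans (leqSpred _) _; rewrite ltnS leq_maxl.
- by apply: leq_trans (leqSpred _) _; rewrite ltnS leq_maxr.
have VF0 : FracField.tofrac V%:S != 0 by rewrite tofrac_eq0 mps_of_mpoly_eq0.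
apply/eqP; rewrite -tofrac_eq rmorphM /= aE mulrC divfK //.
Qed.

(** The exponents [l i] vary with i, so all equations are iterated up to the common exponent L * e,
    where L is the product of the [l i] and e makes the power r^(L * e) trivial on k. The constant
    term 1 of f_i keeps its multiplier, hence U, nonzero modulo p. *)
Lemma lucas_reduction n (f : 'I_n -> mps d K) (fA : 'I_n -> mps d (locring p)) C :
  (0 < n)%N -> (forall i, mps_map loc (fA i) = f i) -> (forall i, f i 0%MM = 1) ->
  finite_index p ->
  (forall i, exists2 q : nat, q \in [pchar {ideal_quot p}] &
    exists (l : nat) (a : mps d K),
      [/\ (0 < l)%N, ratfun (FracField.tofrac a), mps_over (localization p) a,
          mps_over (localization_max p) (f i - a * mps_subst_pow (q ^ l) (f i))
        & exists2 h, has_height (FracField.tofrac a) h & (h <= C * q ^ l)%N]) ->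
  exists r j (U V : 'I_n -> {mpoly k[d]}),
    [/\ r \in [pchar k], (0 < j)%N, forall y : k, y ^+ (r ^ j) = y,
        forall i, U i != 0 /\ V i != 0 &
        forall i, [/\ (V i)%:S * mps_map res (fA i) =
                      (U i)%:S * mps_map res (fA i) ^+ (r ^ j),
                      (msize (U i) <= (2 * C * (r ^ j).-1).+1)%N
                    & (msize (V i) <= (2 * C * (r ^ j).-1).+1)%N]].
Proof.
move=> n_gt0 fAE f0 finp lucasf.
have [r rp _] := lucasf (Ordinal n_gt0).
have rk := pchar_fraction_quot rp.
have /choice[l lP] : forall i, exists l : nat, (0 < l)%N /\
    exists (a : mps d K), [/\ mps_over (localization p) a,
          mps_over (localization_max p) (f i - a * mps_subst_pow (r ^ l) (f i))
        & exists2 h, has_height (FracField.tofrac a) h & (h <= C * r ^ l)%N].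
  move=> i.
  have [q qp [l [a [l_gt0 _ ap amax ah]]]] := lucasf i.
  have qr : q = r.
    by have := pchar_fraction_quot qp; rewrite (pcharf_eq rk) => /eqP.
  by exists l; split=> //; exists a; rewrite -qr.
pose L := (\prod_i l i)%N.
have L_gt0 : (0 < L)%N by rewrite prodn_gt0 // => i; case: (lP i).
have [e e_gt0 fixk] := finite_index_frobenius finp rk L_gt0.
have r_gt1 : (1 < r)%N by rewrite prime_gt1 // (pcharf_prime rk).
have main i : exists UV : {mpoly k[d]} * {mpoly k[d]},
    [/\ UV.1 != 0, UV.2 != 0,
     UV.2%:S * mps_map res (fA i) = UV.1%:S * mps_map res (fA i) ^+ (r ^ (L * e)),
     (msize UV.1 <= (2 * C * (r ^ (L * e)).-1).+1)%N
   & (msize UV.2 <= (2 * C * (r ^ (L * e)).-1).+1)%N].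
  have [l_gt0 [a [ap amax [h ah hC]]]] := lP i.
  have [aA aAE] := lift_locring ap.
  have hm : exists U V : {mpoly K[d]}, [/\ V != 0, (msize U <= h.+1)%N, (msize V <= h.+1)%N &
      V%:S * mps_map loc aA = U%:S] by rewrite aAE; exact: has_height_mpoly.
  have [U [V [V0 sU sV VU]]] := rational_reduction res locval_inj hm.
  have gE : mps_map res (fA i) = mps_map res aA * mps_subst_pow (r ^ l i) (mps_map res (fA i)).
    by apply: residue_functional_equation; rewrite fAE aAE.
  have g0 : mps_map res (fA i) 0%MM = 1.
    have -> : mps_map res (fA i) 0%MM = res (fA i 0%MM) by [].
    rewrite -[RHS](rmorph1 res); congr (res _); apply: locval_inj.
    by have := f0 i; rewrite -fAE /= => ->; rewrite [RHS]rmorph1.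
  have a0 : mps_map res aA != 0.
    apply/eqP => e0; move: gE; rewrite e0 mul0r => /mpsP /(_ 0%MM).
    by rewrite g0 => /eqP; rewrite oner_eq0.
  have U0 : U != 0 by rewrite -mps_of_mpoly_eq0 -VU mulf_neq0 // mps_of_mpoly_eq0.
  pose e' := (\prod_(x | x != i) l x * e)%N.
  have LE : (L * e = l i * e')%N by rewrite /L (bigD1 i) //= mulnA.
  have e'_gt0 : (0 < e')%N.
    by rewrite muln_gt0 e_gt0 andbT prodn_cond_gt0 // => x _; case: (lP x).
  have fixk' (y : k) : y ^+ (r ^ (l i * e')) = y by rewrite -LE.
  have Vg : V%:S * mps_map res (fA i) = U%:S * mps_subst_pow (r ^ l i) (mps_map res (fA i)).
    by rewrite {1}gE mulrA VU.
  have [U' [V' [U'0 V'0 Vg' [h' hE [sU' sV']]]]] :=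
    iterate_functional_equation rk e'_gt0 fixk' U0 V0 sU sV Vg.
  (* With q = r^(l i) at least 2, h <= C * q <= 2 * C * (q - 1); this is the origin of the factor
     2. *)
  have le_h' : (h' <= 2 * C * (r ^ (l i * e')).-1)%N.
    have q_gt1 : (1 < r ^ l i)%N by rewrite -(expn0 r) ltn_exp2l.
    have q1 : (0 < (r ^ l i).-1)%N by rewrite -ltnS prednK // ltnW.
    rewrite -(leq_pmul2r q1) hE mulnAC leq_mul2r; apply/orP; right.
    apply: leq_trans hC _; rewrite mulnAC mulnC leq_mul2r; apply/orP; right.
    by case: (r ^ l i)%N q_gt1 q1 => // x _ /= x_gt0; rewrite mul2n -addnn -addn1 leq_add2l.
  exists (U', V'); rewrite LE; split=> //=.
    by apply: leq_trans sU' _; rewrite ltnS.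
  by apply: leq_trans sV' _; rewrite ltnS.
have [UV UVP] := choice main.
exists r, (L * e)%N, (fun i => (UV i).1), (fun i => (UV i).2); split=> //.
- by rewrite muln_gt0 L_gt0.
- by move=> i; case: (UVP i).
- by move=> i; case: (UVP i).
Qed.
End LucasReduction.

(** * Algebraic independence *)

(** The witness is chosen before [p]. If the system over the fraction field has no nonzero solution,
    some maximal minor has a nonzero coefficient, and the numerator of that coefficient serves:
    outside the primes containing it, the minor stays nonzero after reduction. *)
Lemma pade_obstruction (R : idomainType) (d N : nat) (u v : mps d {fraction R}) :
  exists2 b : R, b != 0 &
    forall (p : prime_idealr R) (uA vA : mps d (locring p)),
      mps_map (@locval R p) uA = u -> mps_map (@locval R p) vA = v ->
      b \notin p ->
      has_kernel (fun t c => FracField.tofrac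
        (@pade_mx d _ N (mps_map (@residue R p) uA) (mps_map (@residue R p) vA) t c)) ->
      has_kernel (fun t c => FracField.tofrac (@pade_mx d _ N u v t c)).
Proof.
have [ker|nker] := pselect (has_kernel (fun t c => FracField.tofrac (@pade_mx d _ N u v t c))).
  by exists 1; rewrite ?oner_neq0.
pose J : finType := ('I_N.+1 * bool)%type.
pose minor (F : idomainType) (u v : mps d F) r :=
  maximal_minor (@pade_mx d F N u v : nat -> J -> _) r.
have minorE (F : idomainType) u' v' (r : 'I_#|J| -> nat) :
    maximal_minor (fun t (c : J) => FracField.tofrac (@pade_mx d F N u' v' t c)) r =
    FracField.tofrac (minor F u' v' r) by rewrite map_maximal_minor.
have [r det0] : exists r, minor _ u v r != 0.
  apply: contrapT => nr; apply: nker; apply/has_kernelP => r.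
  rewrite minorE; apply/eqP; rewrite tofrac_eq0; apply/negPn/negP => nz.
  by apply: nr; exists r.
have [m Dm] : exists m, (minor _ u v r)@_m != 0.
  apply: contrapT => nm; case/eqP: det0; apply/mpolyP => m; rewrite mcoeff0.
  by apply/eqP/negPn/negP => nz; apply: nm; exists m.
have [a [b [b0 DE]]] := fractionP (minor _ u v r)@_m.
exists a; first by apply: contraNneq Dm => a0; rewrite DE a0 rmorph0 mul0r.
move=> p uA vA uE vE ap /has_kernelP /(_ r).
have mapE (F : idomainType) (h : {rmorphism locring p -> F}) :
    minor _ (mps_map h uA) (mps_map h vA) r =
    map_mpoly h (maximal_minor (@pade_mx d _ N uA vA : nat -> J -> _) r).
  rewrite (map_maximal_minor (map_mpoly h)); congr maximal_minor.
  by apply/funext => t; apply/funext => c; apply/esym/map_pade_mx.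
rewrite minorE => /eqP; rewrite tofrac_eq0 => /eqP.
rewrite (mapE _ (@residue R p)) => /mpolyP /(_ m).
rewrite mcoeff_map_mpoly mcoeff0 => res0.
move: DE; rewrite -uE -vE (mapE _ (@locval R p)) mcoeff_map_mpoly => DE.
by case/negP: ap; exact: (residue_eq0 b0 DE res0).
Qed.

Section RationalFunctions.
Variables (d n : nat) (K : fieldType).
Local Notation L := {fraction mps d K}.
Local Notation "A %:S" := (mps_of_mpoly A) (at level 2, format "A %:S").
Local Notation frac := (@FracField.tofrac (mps d K)).

Lemma ratfun1 : ratfun (1 : L).
Proof. by exists 1, 1; rewrite oner_neq0 /ratfrac !rmorph1 divr1. Qed.

Lemma ratfun0 : ratfun (0 : L).
Proof. by exists 0, 1; rewrite oner_neq0 /ratfrac !rmorph0 mul0r. Qed.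

Lemma ratfunN (z : L) : ratfun z -> ratfun (- z).
Proof.
by move=> [A [B [B0 ->]]]; exists (- A), B; rewrite /ratfrac !rmorphN mulNr.
Qed.

Lemma dependent_polynomial_relation (f : 'I_n -> mps d K) :
  algebraically_dependent ratfun (fun i => frac (f i)) ->
  exists D (c : 'X_{1..n < D} -> {mpoly K[d]}),
    (exists i, c i != 0) /\
    \sum_i (c i)%:S * \prod_(l < n) f l ^+ (i : 'X_{1..n}) l = 0.
Proof.
move=> [P [P0 Prat Pf]].
pose D := msize P.
have /choice[AB ABP] : forall i : 'X_{1..n < D}, exists AB : {mpoly K[d]} * {mpoly K[d]},
    AB.2 != 0 /\ P@_i = ratfrac AB.1 AB.2.
  by move=> i; have [A [B h]] := Prat i; exists (A, B).
pose c i := (AB i).1 * \prod_(l | l != i) (AB l).2.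
pose B := \prod_i (AB i).2.
have B0 : B != 0 by apply/prodf_neq0 => i _; case: (ABP i).
have cE i : frac (c i)%:S = frac B%:S * P@_i.
  have [Bi0 ->] := ABP i; rewrite /ratfrac /B (bigD1 i) //= /c.
  rewrite !(rmorphM (@mps_of_mpoly d K)) !(rmorphM frac).
  by rewrite [RHS](AC (2*2) ((3*2)*(1*4))) /= mulfV ?mulr1 // tofrac_eq0 mps_of_mpoly_eq0.
exists D, c; split.
  have [m Pm] : exists m, P@_m != 0.
    by exists (mlead P); rewrite mleadc_eq0.
  have lt_m : (mdeg m < D)%N by apply: msize_mdeg_lt; rewrite mcoeff_msupp.
  exists (BMultinom lt_m); rewrite -mps_of_mpoly_eq0 -tofrac_eq0 cE.
  by apply: mulf_neq0; [rewrite tofrac_eq0 mps_of_mpoly_eq0; exact: B0 | exact: Pm].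
apply/eqP; rewrite -tofrac_eq0 rmorph_sum /=; apply/eqP.
transitivity (frac B%:S * P.@[fun i => frac (f i)]); last by rewrite Pf mulr0.
rewrite [in RHS](mpolywE (leqnn D)) raddf_sum mulr_sumr /=; apply: eq_bigr => i _.
rewrite mevalZ mevalX rmorphM /= cE -mulrA; congr (_ * (_ * _)).
by rewrite rmorph_prod; apply: eq_bigr => l _; rewrite rmorphXn.
Qed.

Lemma multiplicative_of_ratio (f : 'I_n -> mps d K) (m m' : 'X_{1..n})
    (P Q : {mpoly K[d]}) :
  (forall i, f i != 0) -> m != m' -> P != 0 ->
  P%:S * \prod_(i < n) f i ^+ m i = Q%:S * \prod_(i < n) f i ^+ m' i ->
  exists a : 'I_n -> int, (exists i, a i != 0) /\
    ratfun (\prod_(i < n) frac (f i) ^ a i).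
Proof.
move=> f0 ne P0 PQ; exists (fun i => (m i)%:Z - (m' i)%:Z); split.
  apply: contrapT => na; case/eqP: ne; apply/mnmP => i; apply/eqP.
  apply: contrapT => /negP nei; apply: na; exists i.
  by rewrite subr_eq0.
exists Q, P; split=> //.
have F0 i : frac (f i) != 0 by rewrite tofrac_eq0.
have -> : \prod_(i < n) frac (f i) ^ ((m i)%:Z - (m' i)%:Z) =
    frac (\prod_(i < n) f i ^+ m i) / frac (\prod_(i < n) f i ^+ m' i).
  rewrite !rmorph_prod -prodfV -big_split; apply: eq_bigr => i _ /=.
  by rewrite expfzDr // -invr_expz !rmorphXn.
apply/eqP; rewrite eqr_div.
- by rewrite -!rmorphM tofrac_eq mulrC PQ.
- by rewrite tofrac_eq0; apply/prodf_neq0 => i _; rewrite expf_neq0.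
- by rewrite tofrac_eq0 mps_of_mpoly_eq0.
Qed.

(** The relation is X^m - r * X^m', where m and m' are the positive and negative parts of [a]. *)
Lemma dependent_of_multiplicative (f : 'I_n -> mps d K) (a : 'I_n -> int) :
  (forall i, f i != 0) -> (exists i, a i != 0) ->
  ratfun (\prod_(i < n) frac (f i) ^ a i) ->
  algebraically_dependent ratfun (fun i => frac (f i)).
Proof.
move=> f0 [i0 ai0] rat; set r := \prod_(i < n) _ in rat.
pose m := [multinom (if (0 <= a i)%R then `|a i|%N else 0%N) | i < n].
pose m' := [multinom (if (0 <= a i)%R then 0%N else `|a i|%N) | i < n].
have ne : m != m'.
  apply/eqP => /mnmP /(_ i0); rewrite !mnmE.
  by case: ifP => _ /eqP; rewrite ?[0%N == _]eq_sym absz_eq0 (negPf ai0).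
have F0 i : frac (f i) != 0 by rewrite tofrac_eq0.
exists ('X_[m] - r *: 'X_[m']); split.
- apply/eqP => /mpolyP /(_ m).
  rewrite mcoeffB mcoeffZ !mcoeffX eqxx eq_sym (negPf ne) mulr0 subr0 mcoeff0.
  by move/eqP; rewrite oner_eq0.
- move=> l; rewrite mcoeffB mcoeffZ !mcoeffX.
  have [<-|_] := eqVneq m l.
    by rewrite eq_sym (negPf ne) mulr0 subr0; exact: ratfun1.
  rewrite sub0r; apply: ratfunN; case: eqP => _; rewrite ?mulr1 // mulr0.
  exact: ratfun0.
- rewrite mevalB mevalZ !mevalX; apply/eqP; rewrite subr_eq0; apply/eqP.
  rewrite /r -big_split; apply: eq_bigr => i _ /=; rewrite !mnmE.
  case: ifP => a0; first by rewrite expr0 mulr1 -{2}(gez0_abs a0).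
  have {1}-> : a i = - (`|a i|%N)%:Z.
    by rewrite lez0_abs ?opprK // ltW // ltNge a0.
  by rewrite expr0 -invr_expz mulVf // expf_neq0.
Qed.
End RationalFunctions.

(** * Reducing the relation modulo a prime, and conclusion *)

Lemma polynomial_denominator (R : idomainType) (d : nat) (I : finType)
    (c : I -> {mpoly {fraction R}[d]}) :
  exists2 b : R, b != 0 & exists c' : I -> {mpoly R[d]},
    forall i, map_mpoly (@FracField.tofrac R) (c' i) = FracField.tofrac b *: c i.
Proof.
pose B := (\max_i msize (c i))%N.
have [b b0 [y yE]] := common_denominator (fun il : I * 'X_{1..d < B} => (c il.1)@_il.2).
exists b => //; exists (fun i => \sum_(l : 'X_{1..d < B}) y (i, l) *: 'X_[l]) => i.
apply/mpolyP => m; rewrite mcoeff_map_mpoly mcoeffZ raddf_sum /=.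
have [lt|ge] := ltnP (mdeg m) B.
  rewrite (bigD1 (BMultinom lt)) //= mcoeffZ mcoeffX eqxx mulr1 big1 ?addr0 ?yE //.
    exact/esym/(yE (i, BMultinom lt)).
  move=> l ne; rewrite mcoeffZ mcoeffX; case: eqP => [e|_]; last by rewrite mulr0.
  by case/eqP: ne; apply/val_inj.
rewrite big1 ?rmorph0 => [|l _].
  rewrite memN_msupp_eq0 ?mulr0 //; apply: msize_mdeg_ge.
  by apply: leq_trans ge; rewrite /B (leq_bigmax (F := fun i => msize (c i))).
rewrite mcoeffZ mcoeffX; case: eqP => [e|_]; last by rewrite mulr0.
by move: ge; rewrite -e leqNgt bmdeg.
Qed.

(** Over [A] the polynomial coefficients are turned into series by hand, since [mps_of_mpoly] is
    defined over fields. *)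
Lemma mps_map_relation (d n : nat) (A : comNzRingType) (K : fieldType)
    (h : {rmorphism A -> K}) (I : finType) (mon : I -> 'X_{1..n})
    (c : I -> {mpoly A[d]}) (f : 'I_n -> mps d A) :
  mps_map h (\sum_i MPs (fun l => (c i)@_l) * \prod_(l < n) f l ^+ mon i l) =
  \sum_i mps_of_mpoly (map_mpoly h (c i)) * \prod_(l < n) mps_map h (f l) ^+ mon i l.
Proof.
rewrite rmorph_sum; apply: eq_bigr => i _; rewrite rmorphM rmorph_prod; congr (_ * _).
  by apply/mpsP => m /=; rewrite mcoeff_map_mpoly.
by apply: eq_bigr => l _; rewrite rmorphXn.
Qed.

Lemma mps_map_eq0 (d : nat) (A B : comNzRingType) (h : {rmorphism A -> B}) (f : mps d A) :
  injective h -> mps_map h f = 0 -> f = 0.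
Proof.
move=> inj_h e; apply/mpsP => m; apply: inj_h.
by apply: etrans (esym (rmorph0 h)); move/mpsP/(_ m): e.
Qed.

Lemma map_locval_to_loc (R : idomainType) (p : prime_idealr R) d (P : {mpoly R[d]}) :
  map_mpoly (@locval R p) (map_mpoly (@to_loc R p) P) = map_mpoly (@FracField.tofrac R) P.
Proof.
apply/mpolyP => m; apply: etrans (mcoeff_map_mpoly _ _ _) _.
apply: etrans (esym (mcoeff_map_mpoly _ _ _)).
apply: etrans (congr1 (@locval R p) (mcoeff_map_mpoly _ _ _)) _.
exact: locval_to_loc.
Qed.

Lemma coef_residue_to_loc (R : idomainType) (p : prime_idealr R) d (P : {mpoly R[d]}) m :
  (map_mpoly (@residue R p) (map_mpoly (@to_loc R p) P))@_m =
  FracField.tofrac (to_quot p P@_m).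
Proof.
apply: etrans (mcoeff_map_mpoly _ _ _) _.
apply: etrans (congr1 (@residue R p) (mcoeff_map_mpoly _ _ _)) _.
exact: residue_to_loc.
Qed.

Theorem theorem4p1 (R : idomainType) (d n : nat) (S : set (prime_idealr R))
    (f : 'I_n -> mps d {fraction R}) :
  dedekind R -> (0 < d)%N ->
  infinite_set S -> (forall p, S p -> finite_index p) ->
  (forall i, lucas S (f i)) ->
  algebraically_dependent ratfun (fun i => FracField.tofrac (f i)) <->
  exists a : 'I_n -> int, (exists i, a i != 0) /\
    ratfun (\prod_(i < n) FracField.tofrac (f i) ^ a i).
Proof.
move=> dedR _ infS finS lucasf.
have f0 i : f i 0%MM = 1 by case: (lucasf i).
have nzf i : f i != 0.
  by apply/eqP => e; have := f0 i; rewrite e => /eqP; rewrite eq_sym oner_eq0.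
split; last by move=> [a [ane rat]]; exact: dependent_of_multiplicative rat.
(* For n = 0 a polynomial is a constant equal to its value, so a nonzero one cannot vanish. *)
move=> dep; have n_gt0 : (0 < n)%N.
  case: n f f0 nzf lucasf dep => // f _ _ _ [P [P0 _]].
  rewrite (nvar0_mpolyC P) mevalC => z; case/eqP: P0.
  by rewrite (nvar0_mpolyC P) z mpolyC0.
have [D [c [[i0 ci0] rel]]] := dependent_polynomial_relation dep.
have [b b0 [c' c'E]] := polynomial_denominator c.
have /choice[Cf CfP] i : exists C : nat, forall p, S p ->
    [/\ mps_over (localization p) (f i), finite_index p
      & exists2 q : nat, q \in [pchar {ideal_quot p}] &
        exists (k : nat) (a : mps d {fraction R}),
          [/\ (0 < k)%N, ratfun (FracField.tofrac a), mps_over (localization p) a,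
              mps_over (localization_max p) (f i - a * mps_subst_pow (q ^ k) (f i))
            & exists2 h, has_height (FracField.tofrac a) h & (h <= C * q ^ k)%N]].
  by case: (lucasf i) => _ [C _ CP]; exists C.
pose C := (\sum_i Cf i)%N.
(* The size in [pade_kernel_pchar] for B = 2 * C, the bound of [lucas_reduction]. It is known before
   p, so the obstructions [z] can be fixed first. *)
pose N := (2 * C * D + 2 * C * D)%N.
pose F (m : 'X_{1..n}) := \prod_(i < n) f i ^+ m i.
have /choice[z zP] : forall il : 'X_{1..n < D} * 'X_{1..n < D}, exists z : R, z != 0 /\
    forall (p : prime_idealr R) (uA vA : mps d (locring p)),
      mps_map (@locval R p) uA = F il.1 -> mps_map (@locval R p) vA = F il.2 ->
      z \notin p ->
      has_kernel (fun t c => FracField.tofrac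
        (@pade_mx d _ N (mps_map (@residue R p) uA) (mps_map (@residue R p) vA) t c)) ->
      has_kernel (fun t c => FracField.tofrac (@pade_mx d _ N (F il.1) (F il.2) t c)).
  by move=> il; have [z z0 h] := pade_obstruction N (F il.1) (F il.2); exists z.
have [k0 ck0] : exists k0, (c' i0)@_k0 != 0.
  apply: contrapT => nk; case/eqP: ci0; apply/mpolyP => k0; rewrite mcoeff0.
  apply/eqP/negPn/negP => nz; apply: nk; exists k0.
  rewrite -tofrac_eq0 -mcoeff_map_mpoly c'E mcoeffZ.
  by apply: mulf_neq0; [rewrite tofrac_eq0; exact: b0 | exact: nz].
(* Avoiding the first factor keeps the reduced relation nontrivial; avoiding the others, one for
   each pair of monomials, brings solvability back from the residue field to K. *)
have [p Sp] : exists2 p : prime_idealr R, S p & (c' i0)@_k0 * \prod_il z il \notin p.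
  apply: infinite_primes_avoid => //; rewrite mulf_neq0 //.
  by apply/prodf_neq0 => il _; case: (zP il).
rewrite prime_idealrM negb_or => /andP[ck0p zp].
have zpi il : z il \notin p.
  by apply: contraNN zp => zilp; rewrite (bigD1 il) //= prime_idealrM zilp.
have /choice[fA fAE] i : exists fA, mps_map (@locval R p) fA = f i.
  by apply: lift_locring; case: (CfP i p Sp).
have [|r [j [U [V [rk j_gt0 fixk UV0 UVP]]]]] :=
    @lucas_reduction d R p n f fA C n_gt0 fAE f0 (finS _ Sp).
  move=> i; have [_ _ [q qp [k [a [k_gt0 arat aloc amax [h ah hC]]]]]] := CfP i p Sp.
  exists q => //; exists k, a; split=> //; exists h => //.
  by apply: leq_trans hC _; rewrite leq_mul2r /C (bigD1 i) //= leq_addr orbT.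
pose g i := mps_map (@residue R p) (fA i).
have g0 i : g i 0%MM = 1.
  rewrite /g /= -[RHS](rmorph1 (@residue R p)); congr (residue _).
  by apply: locval_inj; rewrite [RHS]rmorph1 -(f0 i) -fAE.
pose cA i := map_mpoly (@to_loc R p) (c' i).
pose ck i := map_mpoly (@residue R p) (cA i).
have cAE i : map_mpoly (@locval R p) (cA i) = (FracField.tofrac b)%:MP * c i.
  by rewrite mul_mpolyC -c'E map_locval_to_loc.
(* Multiplied by [b], the relation has a meaning over the localization; it holds there because the
   localization embeds in K, and so it can be reduced. *)
pose rA := \sum_i MPs (fun l => (cA i)@_l) * \prod_(l < n) fA l ^+ (i : 'X_{1..n}) l.
have relA : rA = 0.
  apply: (mps_map_eq0 (@locval_inj R p)); rewrite /rA mps_map_relation.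
  transitivity (mps_of_mpoly (FracField.tofrac b)%:MP *
      \sum_i mps_of_mpoly (c i) * \prod_(l < n) f l ^+ (i : 'X_{1..n}) l); last first.
    by rewrite rel mulr0.
  rewrite mulr_sumr; apply: eq_bigr => i _; rewrite mulrA -rmorphM cAE; congr (_ * _).
  by apply: eq_bigr => l _; rewrite fAE.
have relk : \sum_i mps_of_mpoly (ck i) * \prod_(l < n) g l ^+ (i : 'X_{1..n}) l = 0.
  by rewrite -mps_map_relation -/rA relA rmorph0.
have cki0 : exists i, ck i != 0.
  exists i0; apply: contraNneq ck0p => /mpolyP /(_ k0).
  rewrite coef_residue_to_loc mcoeff0 => /eqP.
  by rewrite tofrac_eq0 to_quot_eq0.
have [i1 [i2 [ne ker]]] := @pade_kernel_pchar d n _ r j rk j_gt0 fixk g U V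
  _ (fun i : 'X_{1..n < D} => i : 'X_{1..n}) ck
  (2 * C) D val_inj g0 (fun i => (UV0 i).1) (fun i => (UV0 i).2)
  (fun i => let: And3 h _ _ := UVP i in h) (fun i => let: And3 _ h _ := UVP i in h)
  (fun i => let: And3 _ _ h := UVP i in h) (fun i => ltnW (bmdeg i)) cki0 relk.
pose FA (m : 'X_{1..n}) := \prod_(i < n) fA i ^+ m i.
have mapFA (B : comNzRingType) (h : {rmorphism locring p -> B}) m :
    mps_map h (FA m) = \prod_(i < n) mps_map h (fA i) ^+ m i.
  by rewrite rmorph_prod; apply: eq_bigr => i _; rewrite rmorphXn.
have FAE m : mps_map (@locval R p) (FA m) = F m.
  by rewrite mapFA; apply: eq_bigr => i _; rewrite fAE.
have FAg m : mps_map (@residue R p) (FA m) = \prod_(i < n) g i ^+ m i by exact: mapFA.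
have Fnz m : F m != 0 by apply/prodf_neq0 => i _; rewrite expf_neq0.
have kerK : has_kernel (fun t c => FracField.tofrac (@pade_mx d _ N (F i1) (F i2) t c)).
  have [_ h] := zP (i1, i2); apply: (h p (FA i1) (FA i2) (FAE i1) (FAE i2) (zpi (i1, i2))).
  by rewrite !FAg; exact: ker.
have [P [Q [P0 _ PQ]]] := pade_kernel_ratfun (Fnz i1) (Fnz i2) kerK.
exact: multiplicative_of_ratio PQ.
Qed.
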